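(* Let $p\in\mathbb N$ and $t>0$. If $d_1=\cdots=d_p=1$ and $d_{p+1}=t$, then the numbers $P_k(d_1,\dots,d_{p+1})$, $k\in\mathbb N$, are the moments of the free Bessel law $\pi_{p,t}$, i.e. $P_k(1,\dots,1,t)=\int x^k\,d\pi_{p,t}(x)$.
   Context: Polynomials $P_k$. Let $W_k=(1\,2\cdots p\,p^*\cdots 2^*1^* )^k$, a word of length $2kp$ in the letters $1,\dots,p,1^*,\dots,p^*$. Let $\mathcal{NC}^2(W_k)$ be the set of noncrossing pair partitions $\pi$ of $\{1,\dots,2kp\}$ such that the two positions of every block carry letters $j$ and $j^*$ for some $j\in\{1,\dots,p\}$ (in either order). For $\pi\in\mathcal{NC}^2(W_k)$ let $\mathcal R_j(\pi)$ and $\mathcal R_j^*(\pi)$ be the sets of right legs (larger elements of blocks) of $\pi$ which carry the letter $j$ and $j^*$, respectively, with $\mathcal R_0^*(\pi)=\emptyset$ and $\mathcal R_{p+1}(\pi)=\emptyset$. Put $r_j(\pi)=|\mathcal R_j(\pi)|+|\mathcal R_{j-1}^*(\pi)|$ for $1\le j\le p+1$ and $P_k(d_1,\dots,d_{p+1})=\sum_{\pi\in\mathcal{NC}^2(W_k)}d_1^{\,r_1(\pi)}\cdots d_{p+1}^{\,r_{p+1}(\pi)}$. Free Bessel laws: $\pi_{p,t}=\pi^{\boxtimes(p-1)}\boxtimes\pi^{\boxplus t}$, where $\boxtimes$ and $\boxplus$ are the free multiplicative and free additive convolutions and $\pi$ is the Marchenko-Pastur (free Poisson) distribution with shape parameter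 $1$, $d\pi=\frac{\sqrt{x(4-x)}}{2\pi x}1_{[0,4]}(x)\,dx$ (the symbol $\pi$ in the denominator being the number $3.14\ldots$). *)

(* Defs.v *)
From HB Require Import structures.
From mathcomp Require Import all_boot all_order all_algebra.
From mathcomp Require Import complex.
From mathcomp Require Import all_classical all_reals all_analysis.
From mathcomp Require Import measurable_realfun.

Set Implicit Arguments.
Unset Strict Implicit.
Unset Printing Implicit Defensive.

Import Order.TTheory GRing.Theory Num.Theory.
Import numFieldNormedType.Exports.

Local Open Scope ring_scope.

Definition noncrossing (n : nat) (V : {set {set 'I_n}}) : bool :=
  [forall A in V, forall B in V,
   forall a in A, forall b in B, forall a' in A, forall b' in B,
     [&& (a < b)%N, (b < a')%N & (a' < b')%N] ==> (A == B)].

Definition NC (n : nat) : {set {set {set 'I_n}}} :=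
  [set V : {set {set 'I_n}} | finset.partition V [set: 'I_n] & noncrossing V].

(* The letter j is (j, false) and the letter j^* is (j, true). *)
Definition letter : Type := (nat * bool)%type.

Definition word (p k : nat) : seq letter :=
  flatten (nseq k ([seq (j, false) | j <- iota 1 p] ++
                   [seq (j, true) | j <- rev (iota 1 p)])).

Lemma size_word (p k : nat) : size (word p k) = (2 * k * p)%N.
Proof.
elim: k => [|k IHk]; first by rewrite muln0.
rewrite /word /= size_cat -/(word p k) IHk size_cat !size_map size_rev size_iota.
by rewrite addnn -mul2n mulnS mulnDl.
Qed.

(* The position i : 'I_(2 * k * p) stands for the position i.+1 of W_k; by
   size_word the default letter is never used. *)
Definition letter_at (p k : nat) (i : 'I_(2 * k * p)) : letter :=
  nth (0%N, false) (word p k) i.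

Definition NC2 (p k : nat) : {set {set {set 'I_(2 * k * p)}}} :=
  [set V in NC (2 * k * p) |
    [forall B in V, #|B| == 2%N] &
    [forall B in V, forall x in B, forall y in B, (x != y) ==>
       ((letter_at x).1 == (letter_at y).1) &&
       ((letter_at x).2 != (letter_at y).2)]].

Definition right_legs (p k : nat) (V : {set {set 'I_(2 * k * p)}})
    (l : letter) : {set 'I_(2 * k * p)} :=
  [set i | (letter_at i == l) &&
           [exists B in V, (i \in B) && [forall i' in B, (i' <= i)%N]]].

(* The conventions that R_0^* and R_(p+1) are empty hold by themselves, as only
   the letters j and j^* with 1 <= j <= p occur in the word. *)
Definition r_exp (p k : nat) (V : {set {set 'I_(2 * k * p)}}) (j : nat) : nat :=
  (#|right_legs V (j, false)| + #|right_legs V (j.-1, true)|)%N.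

(* Only the values d 1, ..., d p.+1 are used. *)
Definition Pk (R : comNzRingType) (p k : nat) (d : nat -> R) : R :=
  \sum_(V in NC2 p k) \prod_(1 <= j < p.+2) d j ^+ r_exp V j.

Notation real_measure R := {measure set (measurableTypeR R) -> \bar R}.
Notation real_prob R := (probability (measurableTypeR R) R).

Section Measures.
Local Open Scope classical_set_scope.
Context {R : realType}.

Definition has_moments (mu : real_measure R) (m : nat -> R) : Prop :=
  forall n : nat, (\int[mu]_x (x ^+ n)%:E = (m n)%:E)%E.

Definition compactly_supported (mu : real_measure R) : Prop :=
  exists M : R, mu (~` `[- M, M]) = 0%E.

Definition nonneg_supported (mu : real_measure R) : Prop :=
  mu `]-oo, 0[ = 0%E.

Definition marchenko_pastur_pdf (x : R) : R :=
  if 0 <= x <= 4 then Num.sqrt (x * (4 - x)) / (2 * pi * x) else 0.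

Lemma marchenko_pastur_pdf_ge0 (x : R) : 0 <= marchenko_pastur_pdf x.
Proof.
rewrite /marchenko_pastur_pdf; case: ifPn => // /andP[x0 _].
by rewrite divr_ge0 ?sqrtr_ge0// mulr_ge0// mulr_ge0// pi_ge0.
Qed.

Let measurable_inv : measurable_fun [set: measurableTypeR R] (@GRing.inv R).
Proof.
rewrite -(setvU [set 0 : R]); apply/measurable_funU => //.
  exact: measurableC.
split; last exact: measurable_fun_set1.
apply: open_continuous_measurable_fun => [|x /set_mem /= /eqP x0].
  by apply: closed_openC; exact: closed_eq.
exact: inv_continuous.
Qed.

Lemma measurable_marchenko_pastur_pdf :
  measurable_fun [set: measurableTypeR R] marchenko_pastur_pdf.
Proof.
rewrite /marchenko_pastur_pdf; apply: measurable_fun_if => //=.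
  by apply: measurable_and => //; exact: measurable_fun_ler.
apply: measurable_funTS; apply: measurable_funM.
  apply: measurableT_comp.
    by apply: continuous_measurable_fun; exact: sqrt_continuous.
  by apply: measurable_funM => //; exact: measurable_funB.
by apply: (measurableT_comp measurable_inv); exact: measurable_funM.
Qed.

(* At the point 0 the density takes the value 0, since 0^-1 = 0. *)
Definition marchenko_pastur (A : set (measurableTypeR R)) : \bar R :=
  (\int[lebesgue_measure]_(x in A) (marchenko_pastur_pdf x)%:E)%E.

Let marchenko_pastur0 : marchenko_pastur set0 = 0%E.
Proof. by rewrite /marchenko_pastur integral_set0. Qed.

Let marchenko_pastur_ge0 A : (0 <= marchenko_pastur A)%E.
Proof.
by apply: integral_ge0 => x _; rewrite lee_fin marchenko_pastur_pdf_ge0.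
Qed.

Let marchenko_pastur_sigma_additive : semi_sigma_additive marchenko_pastur.
Proof.
move=> /= F mF tF mUF; rewrite /marchenko_pastur; apply: cvg_toP.
  apply: ereal_nondecreasing_is_cvgn => m n mn.
  apply: lee_sum_nneg_natr => // k _ _.
  by apply: integral_ge0 => /= x Fkx; rewrite lee_fin marchenko_pastur_pdf_ge0.
rewrite ge0_integral_bigcup//=.
- apply: measurable_funTS; apply: measurableT_comp => //.
  exact: measurable_marchenko_pastur_pdf.
- by move=> x _; rewrite lee_fin marchenko_pastur_pdf_ge0.
Qed.

HB.instance Definition _ := isMeasure.Build _ _ _ marchenko_pastur
  marchenko_pastur0 marchenko_pastur_ge0 marchenko_pastur_sigma_additive.

End Measures.

(* Freeness with respect to phi of the unital algebras generated by a false and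
   by a true: a product of centered elements taken alternately from the two
   algebras is centered.  The entry (i, q) of s stands for q evaluated at a i. *)
Definition free_pair (C : comNzRingType) (A : algType C) (phi : A -> C)
    (a : bool -> A) : Prop :=
  forall s : seq (bool * {poly C}),
    s != [::] ->
    sorted (fun x y => x.1 != y.1) s ->
    (forall x, x \in s -> phi (horner_alg (a x.1) x.2) = 0) ->
    phi (\prod_(x <- s) horner_alg (a x.1) x.2) = 0.

Definition has_distribution (R : realType) (A : algType R[i]) (phi : A -> R[i])
    (a : A) (mu : real_measure R) : Prop :=
  exists2 m : nat -> R,
    has_moments mu m & forall n : nat, phi (a ^+ n) = (m n)%:C%C.

(* rho is the free multiplicative convolution of mu and nu: in some
   noncommutative probability space (A, phi), rho is the distribution of the
   product of free variables a and b with distributions mu and nu.  The supports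
   being compact, the moments determine the measures. *)
Definition free_mul_conv (R : realType) (mu nu rho : real_measure R) : Prop :=
  [/\ compactly_supported mu /\ nonneg_supported mu,
      compactly_supported nu /\ nonneg_supported nu,
      compactly_supported rho /\ nonneg_supported rho &
      exists (A : algType R[i]) (phi : {scalar A}) (a b : A),
        [/\ phi 1 = 1,
            free_pair phi (fun i => if i then b else a),
            has_distribution phi a mu,
            has_distribution phi b nu &
            has_distribution phi (a * b) rho]].

(* The power of exponent 0 is the unit of the convolution, the Dirac mass at 1. *)
Fixpoint free_mul_power (R : realType) (mu : real_measure R) (n : nat)
    (rho : real_prob R) : Prop :=
  match n with
  | 0 => forall A : set (measurableTypeR R), measurable A ->
      rho A = \d_(1 : measurableTypeR R) A
  | n'.+1 => exists2 nu : real_prob R,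
      free_mul_power mu n' nu & free_mul_conv nu mu rho
  end.

(* The moment-cumulant formula; the value kappa 0 is not used. *)
Definition is_free_cumulants (R : realType) (mu : real_measure R)
    (kappa : nat -> R) : Prop :=
  has_moments mu
    (fun n => \sum_(V in NC n) \prod_(B in V) kappa #|B|).

(* For real t > 0 the convolution power of exponent t is defined by
   multiplication of the R-transform, i.e. of all free cumulants, by t.  It
   agrees with the iterated free additive convolution when t is an integer, as
   free cumulants add up under the latter. *)
Definition free_add_power (R : realType) (mu : real_measure R) (t : R)
    (rho : real_prob R) : Prop :=
  [/\ compactly_supported mu, compactly_supported rho &
      exists2 kappa : nat -> R,
        is_free_cumulants mu kappa &
        is_free_cumulants rho (fun n => t * kappa n)].

Definition free_bessel_law (R : realType) (p : nat) (t : R)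
    (mu : real_prob R) : Prop :=
  exists nu1 nu2 : real_prob R,
    [/\ free_mul_power (marchenko_pastur : real_measure R) p.-1 nu1,
        free_add_power (marchenko_pastur : real_measure R) t nu2 &
        free_mul_conv nu1 nu2 mu].

(* Main.v *)
From HB Require Import structures.
Require Import Defs.
From mathcomp Require Import all_boot all_order all_algebra.
From mathcomp Require Import ring lra zify.
From mathcomp Require Import complex.
From mathcomp Require Import all_classical all_reals all_analysis.
From mathcomp Require Import measurable_realfun.

(* The moment series M of mu and the series of the P_k satisfy the same equation
   M = 1 + z M^p (M - 1 + t), which determines them.

   If a and b are free and all the free cumulants of b are equal to s, then the
   Schwinger-Dyson equation phi(c b w) = s phi(c w) + sum_(w = u b v)
   phi(u b) phi(c v), for c in the algebra of a, shows that the moment series M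
   of a b and the moment series f of a are related by M(z) = f(z (s - 1 + M(z))).
   The free cumulants of the Marchenko-Pastur law are all equal to 1, because its
   moments are the Catalan numbers; so f = 1 + z f^n becomes M = 1 + z M^(n+1)
   under multiplication by pi, and M = 1 + z M^n (M - 1 + t) under
   multiplication by the convolution power of exponent t of pi.

   The sum P_k obeys the first-return decomposition of noncrossing pairings: the
   subwords of W_k which have to be considered start and end at the same height
   of the oscillating path 0, 1, ..., p, ..., 1, 0, ..., and the resulting
   recursion is solved by explicit monomials in M and V = 1 + (M - 1) / t. *)

Set Implicit Arguments.
Unset Strict Implicit.
Unset Printing Implicit Defensive.

Import Order.TTheory GRing.Theory Num.Theory.
Import numFieldNormedType.Exports.
Local Open Scope ring_scope.

(** * Formal power series *)

(** Each free convolution enters only through an algebraic identity between moment series. Freeness,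
    however, speaks of alternating centered words alone. Both sides of the Schwinger-Dyson equation
    are therefore extended to arbitrary products of polynomials in a and in b, where they are linear
    in each factor and unchanged when neighbours from one algebra are merged; this reduces the
    equation to words on which freeness kills nearly every term. A general c is needed because the
    equation turns a^k (a b)^(n+1) into terms with a^(k+1): only the whole family over k closes up,
    and it unfolds f(z (s - 1 + M)) term by term.

    The density and the noncrossing partitions meet in the recursion (n + 2) m_(n+1) = (4 n + 2)
    m_n, obtained on one side by integrating an exact derivative and on the other from C = 1 + z
    C^2. It leaves m_0 free; that m_0 = 1 is read off from the moment-cumulant formula at n = 0. *)

Record fps (C : comNzRingType) := Fps { fps_coef :> nat -> C }.

HB.instance Definition _ (C : comNzRingType) := gen_eqMixin (fps C).
HB.instance Definition _ (C : comNzRingType) := gen_choiceMixin (fps C).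

Lemma fpsP (C : comNzRingType) (f g : fps C) : f =1 g -> f = g.
Proof. by case: f g => f [g] /funext /= ->. Qed.

Section FpsRing.
Context {C : comNzRingType}.
Implicit Types f g h : fps C.

Definition fps_const (c : C) : fps C := Fps (fun n => if n is 0 then c else 0).
Definition fps_add f g : fps C := Fps (fun n => f n + g n).
Definition fps_opp f : fps C := Fps (fun n => - f n).
Definition fps_mul f g : fps C :=
  Fps (fun n => \sum_(i < n.+1) f i * g (n - i)%N).

Fact fps_addA : associative fps_add.
Proof. by move=> f g h; apply: fpsP => n /=; rewrite addrA. Qed.
Fact fps_addC : commutative fps_add.
Proof. by move=> f g; apply: fpsP => n /=; rewrite addrC. Qed.
Fact fps_add0 : left_id (fps_const 0) fps_add.
Proof. by move=> f; apply: fpsP => -[|n] /=; rewrite add0r. Qed.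
Fact fps_addN : left_inverse (fps_const 0) fps_opp fps_add.
Proof. by move=> f; apply: fpsP => -[|n] /=; rewrite addNr. Qed.

HB.instance Definition _ :=
  GRing.isZmodule.Build (fps C) fps_addA fps_addC fps_add0 fps_addN.

Let trunc n f : {poly C} := \poly_(i < n.+1) f i.

Let coef_trunc n f i : (i <= n)%N -> (trunc n f)`_i = f i.
Proof. by move=> le_in; rewrite coef_poly ltnS le_in. Qed.

(** Up to degree [n] only finitely many coefficients matter, so commutativity and associativity are
    inherited from polynomials. *)
Let fps_mul_trunc n f g i : (i <= n)%N ->
  fps_mul f g i = (trunc n f * trunc n g)`_i.
Proof.
move=> le_in; rewrite coefM; apply: eq_bigr => j _.
rewrite !coef_trunc //; first exact: leq_trans (leq_subr _ _) le_in.
by apply: leq_trans le_in; rewrite -ltnS.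
Qed.

Fact fps_mulC : commutative fps_mul.
Proof.
by move=> f g; apply: fpsP => n; rewrite !(@fps_mul_trunc n) // mulrC.
Qed.

Fact fps_mulA : associative fps_mul.
Proof.
move=> f g h; apply: fpsP => n.
have mulAl (f1 g1 h1 : fps C) :
    fps_mul (fps_mul f1 g1) h1 n = (trunc n f1 * trunc n g1 * trunc n h1)`_n.
  rewrite coefM; apply: eq_bigr => j _.
  have le_jn : (j <= n)%N by rewrite -ltnS.
  by rewrite (fps_mul_trunc _ _ le_jn) coef_trunc // leq_subr.
by rewrite fps_mulC !mulAl; congr (polyseq _)`_n; ring.
Qed.

Fact fps_mul1 : left_id (fps_const 1) fps_mul.
Proof.
move=> f; apply: fpsP => n /=.
by rewrite big_ord_recl /= mul1r subn0 big1 ?addr0 // => i _; rewrite mul0r.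
Qed.

Fact fps_mulDl : left_distributive fps_mul fps_add.
Proof.
move=> f g h; apply: fpsP => n /=; rewrite -big_split.
by apply: eq_bigr => i _; rewrite mulrDl.
Qed.

Fact fps_1_neq0 : fps_const 1 != 0.
Proof.
by apply/eqP => /(congr1 (fun f : fps C => f 0)) /= /eqP; rewrite oner_eq0.
Qed.

HB.instance Definition _ := GRing.Zmodule_isComNzRing.Build (fps C)
  fps_mulA fps_mulC fps_mul1 fps_mulDl fps_1_neq0.

Definition fpsX : fps C := Fps (fun n => (n == 1%N)%:R).

Definition fps_shift f : fps C := Fps (fun n => f n.+1).

Lemma coef_fps_shift f n : fps_shift f n = f n.+1. Proof. by []. Qed.
Lemma coef_fpsC c n : fps_const c n = if n is 0 then c else 0.
Proof. by []. Qed.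
Lemma coef_fpsD f g n : (f + g) n = f n + g n. Proof. by []. Qed.
Lemma coef_fpsN f n : (- f) n = - f n. Proof. by []. Qed.
Lemma coef_fpsB f g n : (f - g) n = f n - g n. Proof. by []. Qed.
Lemma coef_fpsM f g n : (f * g) n = \sum_(i < n.+1) f i * g (n - i)%N.
Proof. by []. Qed.
Lemma coef_fps1 n : (1 : fps C) n = (n == 0%N)%:R.
Proof. by case: n. Qed.

Lemma coef_fpsXM f n : (fpsX * f) n = if n is n'.+1 then f n' else 0.
Proof.
rewrite coef_fpsM; case: n => [|n]; first by rewrite big_ord1 /= mul0r.
rewrite big_ord_recl big_ord_recl /= mul0r add0r mul1r subn1 big1 ?addr0 //.
by move=> i _; rewrite mul0r.
Qed.

Lemma coef_fpsCM c f n : (fps_const c * f) n = c * f n.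
Proof.
by rewrite coef_fpsM big_ord_recl /= subn0 big1 ?addr0 // => i _; rewrite mul0r.
Qed.

End FpsRing.
Arguments fps_coef : simpl never.

(** * Composition of formal power series *)

Section FpsComp.
Context {C : comNzRingType}.
Variable g : fps C.
Implicit Types f h : fps C.

(* The composite with fpsX * g, which has no constant term. *)
Fixpoint fps_comp_coef (n : nat) f : fps C :=
  if n is n'.+1 then
    fps_const (f 0) + fpsX * g * fps_comp_coef n' (fps_shift f)
  else fps_const (f 0).
Definition fps_comp f : fps C := Fps (fun n => fps_comp_coef n f n).

(** The factor [fpsX] lowers the degree by one; every strong induction on coefficients of composites
    rests on this. *)
Lemma coef_fpsXM_eq (f h : fps C) n : (forall i, (i < n)%N -> f i = h i) ->
  (fpsX * g * f) n = (fpsX * g * h) n.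
Proof.
move=> eq_fh; rewrite -!mulrA !coef_fpsXM; case: n eq_fh => // n eq_fh.
rewrite !coef_fpsM; apply: eq_bigr => i _; rewrite eq_fh // ltnS.
exact: leq_subr.
Qed.

(** Each further unfolding acts behind one more factor [fpsX * g], hence beyond degree [n]. So the
    diagonal coefficients in [fps_comp] are those of a genuine composite. *)
Lemma fps_comp_coef_stable n m f : (n <= m)%N ->
  fps_comp_coef m f n = fps_comp f n.
Proof.
have [N] := ubnP n; elim: N n m f => // N IHN [|n] [|m] f //= lt_nN le_nm.
  by rewrite coef_fpsD -mulrA coef_fpsXM addr0.
rewrite [fps_comp f n.+1]/(fps_coef _ _) /= !coef_fpsD; congr (_ + _).
apply: coef_fpsXM_eq => i lt_in.
have lt_iN : (i < N)%N by apply: leq_trans lt_in _.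
have le_in : (i <= n)%N by [].
have le_im : (i <= m)%N by apply: leq_trans le_in _.
by rewrite !IHN.
Qed.

Lemma fps_compS f :
  fps_comp f = fps_const (f 0) + fpsX * g * fps_comp (fps_shift f).
Proof.
apply: fpsP => -[|n]; first by rewrite coef_fpsD -mulrA coef_fpsXM addr0.
rewrite [LHS]/(fps_coef _ _) /= !coef_fpsD; congr (_ + _).
apply: coef_fpsXM_eq => i lt_in; by rewrite fps_comp_coef_stable // -ltnS.
Qed.

Lemma fps_compD : {morph fps_comp : f h / f + h}.
Proof.
move=> f h; apply: fpsP => n.
have [N] := ubnP n; elim: N n f h => // N IHN n f h lt_nN.
set f' := fps_shift f; set h' := fps_shift h.
have -> : (fps_comp f + fps_comp h) n =
    (fps_const (f 0 + h 0) + fpsX * g * (fps_comp f' + fps_comp h')) n.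
  rewrite (fps_compS f) (fps_compS h); congr (fps_coef _ n).
  have -> : fps_const (f 0 + h 0) = fps_const (f 0) + fps_const (h 0).
    by apply: fpsP => -[|i]; rewrite coef_fpsD !coef_fpsC ?addr0.
  by ring.
rewrite fps_compS !coef_fpsD; congr (_ + _); apply: coef_fpsXM_eq => i lt_in.
have -> : fps_shift (f + h) = f' + h'.
  by apply: fpsP => j; rewrite coef_fps_shift !coef_fpsD.
by rewrite IHN // (leq_trans lt_in).
Qed.

Lemma fps_compCM c f : fps_comp (fps_const c * f) = fps_const c * fps_comp f.
Proof.
apply: fpsP => n; have [N] := ubnP n; elim: N n f => // N IHN n f lt_nN.
set f' := fps_shift f.
have -> : fps_const c * fps_comp f =
    fps_const (c * f 0) + fpsX * g * (fps_const c * fps_comp f').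
  rewrite (fps_compS f).
  have -> : fps_const (c * f 0) = fps_const c * fps_const (f 0).
    by apply: fpsP => -[|i]; rewrite coef_fpsCM !coef_fpsC ?mulr0.
  by ring.
rewrite fps_compS !coef_fpsD coef_fpsCM; congr (_ + _).
apply: coef_fpsXM_eq => i lt_in.
have -> : fps_shift (fps_const c * f) = fps_const c * f'.
  by apply: fpsP => j; rewrite coef_fps_shift !coef_fpsCM.
by rewrite IHN // (leq_trans lt_in).
Qed.

Lemma fps_compXM f : fps_comp (fpsX * f) = fpsX * g * fps_comp f.
Proof.
rewrite fps_compS coef_fpsXM.
have -> : fps_shift (fpsX * f) = f.
  by apply: fpsP => i; rewrite coef_fps_shift coef_fpsXM.
by have -> : fps_const 0 = 0 :> fps C; rewrite ?add0r.
Qed.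

Lemma fps_split f : f = fps_const (f 0) + fpsX * fps_shift f.
Proof.
by apply: fpsP => -[|n]; rewrite coef_fpsD coef_fpsXM coef_fpsC ?addr0 ?add0r.
Qed.

Lemma fps_compM : {morph fps_comp : f h / f * h}.
Proof.
move=> f h; apply: fpsP => n.
have [N] := ubnP n; elim: N n f h => // N IHN n f h lt_nN.
set f' := fps_shift f.
rewrite {1}(fps_split f) mulrDl fps_compD fps_compCM -mulrA fps_compXM.
have -> : fps_comp f * fps_comp h =
    fps_const (f 0) * fps_comp h + fpsX * g * (fps_comp f' * fps_comp h).
  by rewrite (fps_compS f) -/f'; ring.
rewrite !coef_fpsD; congr (_ + _).
by apply: coef_fpsXM_eq => i lt_in; rewrite IHN // (leq_trans lt_in).
Qed.

Lemma fps_comp1 : fps_comp 1 = 1.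
Proof.
rewrite fps_compS (_ : fps_shift 1 = fps_const 0 * 1); last first.
  by apply: fpsP => i; rewrite coef_fps_shift coef_fps1 coef_fpsCM mul0r.
rewrite fps_compCM (_ : fps_const 0 = 0 :> fps C) // mul0r mulr0 addr0.
by apply: fpsP => -[].
Qed.

Lemma fps_compXn f n : fps_comp (f ^+ n) = fps_comp f ^+ n.
Proof.
by elim: n => [|n IHn]; rewrite ?expr0 ?fps_comp1 // !exprS fps_compM IHn.
Qed.

End FpsComp.

(** * Freeness *)

Section Free.
Context {C : comNzRingType} {A : algType C}.
Variables (phi : {scalar A}) (ab : bool -> A).
Hypotheses (phi1 : phi 1 = 1) (free_ab : free_pair phi ab).

Local Notation factor := (bool * {poly C})%type.
Implicit Types (s : seq factor) (c x y : A) (q : {poly C}).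

Let ev (f : factor) : A := horner_alg (ab f.1) f.2.
Let val s : A := \prod_(f <- s) ev f.
Let alternating : seq factor -> bool := sorted (fun f g => f.1 != g.1).
Let centered s := forall f, f \in s -> phi (ev f) = 0.

Let val_nil : val [::] = 1. Proof. exact: big_nil. Qed.
Let val_cons f s : val (f :: s) = ev f * val s. Proof. exact: big_cons. Qed.
Let val_cat s1 s2 : val (s1 ++ s2) = val s1 * val s2.
Proof. exact: big_cat. Qed.
Let val_rcons s f : val (rcons s f) = val s * ev f.
Proof. by rewrite -cats1 val_cat val_cons val_nil mulr1. Qed.

Let evD i k q q' : ev (i, k *: q + q') = k *: ev (i, q) + ev (i, q').
Proof. by rewrite /ev /= -mul_polyC rmorphD rmorphM /= horner_algC mulr_algl. Qed.
Let evM i q q' : ev (i, q * q') = ev (i, q) * ev (i, q').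
Proof. by rewrite /ev rmorphM. Qed.
Let ev1 i : ev (i, 1) = 1.
Proof. by rewrite /ev rmorph1. Qed.
Let evX i : ev (i, 'X) = ab i.
Proof. by rewrite /ev; apply: horner_algX. Qed.

(** Induction on the length of the word: neighbours from the same algebra are merged, and a factor
    is its mean times 1 plus a centered part. Both the merging and the scalar term shorten the word.
    Whether a word alternates depends only on the labels, so centering preserves it. *)
Lemma alternating_centered_ind (P : seq factor -> Prop) :
  (forall s1 i k q q' s2, P (s1 ++ (i, q) :: s2) -> P (s1 ++ (i, q') :: s2) ->
     P (s1 ++ (i, k *: q + q') :: s2)) ->
  (forall s1 i s2, P (s1 ++ s2) -> P (s1 ++ (i, 1) :: s2)) ->
  (forall s1 i q q' s2, P (s1 ++ (i, q * q') :: s2) ->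
     P (s1 ++ (i, q) :: (i, q') :: s2)) ->
  (forall s, alternating s -> centered s -> P s) ->
  forall s, P s.
Proof.
move=> Plin P1 Pmerge Pbase s.
have [n] := ubnP (size s); elim: n s => // n IHn s lt_sn.
have [alt_s|] := boolP (alternating s); last first.
  suff: ~~ alternating s ->
      exists s1 i q q' s2, s = s1 ++ (i, q) :: (i, q') :: s2.
    move=> /[apply] -[s1 [i [q [q' [s2 def_s]]]]]; rewrite def_s.
    apply: Pmerge; apply: IHn; move: lt_sn.
    by rewrite def_s !size_cat /= !addnS.
  elim: (s) => [|[i q] [|[j q'] s'] IHs] //.
  rewrite /alternating /= negb_and negbK => /orP[/eqP <-|/IHs].
    by exists [::], i, q, q', s'.
  by move=> [s1 [i1 [q1 [q2 [s2 ->]]]]]; exists ((i, q) :: s1), i1, q1, q2, s2.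
(* Centering proceeds from left to right; [s1] is the prefix already centered. *)
suff: forall s2 s1, (size (s1 ++ s2) < n.+1)%N -> centered s1 ->
    alternating (s1 ++ s2) -> P (s1 ++ s2).
  by move=> /(_ s [::]) /=; apply.
elim=> [|[i q] s2 IHs] s1 lt_sn1 cent_s1 alt_s1.
  by rewrite cats0 in alt_s1 *; apply: Pbase.
pose e := phi (ev (i, q)).
rewrite (_ : q = e *: 1 + (q - e *: 1)); last by rewrite addrC subrK.
apply: Plin.
  apply: P1; apply: IHn.
  by move: lt_sn1; rewrite !size_cat /= !addnS.
rewrite -cat_rcons; apply: IHs.
- by move: lt_sn1; rewrite cat_rcons !size_cat.
- move=> f; rewrite mem_rcons inE => /orP[/eqP ->|]; last exact: cent_s1.
  by rewrite addrC -scaleNr evD ev1 linearD linearZ /= phi1 mulr1 -/e addNr.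
- move: alt_s1; rewrite cat_rcons /alternating.
  by case: (s1) => [|f s3]; case: (s2) => [|g s4] //=; rewrite !cat_path.
Qed.

(* [beta c x y] is the term of the splitting [val s = u b v] with [x = u] and
   [y = v], and [Delta c x s y] is the sum of these terms over all occurrences of
   [b = ab true] in the factors of [s], in the context [x _ y]. *)
Let beta c x y : C := phi (x * ab true) * phi (c * y).

(** The free difference quotient of [q]: a monomial of degree k is cut at each of its k occurrences
    of the variable. *)
Let delta c x q y : C :=
  \sum_(k < size q) q`_k *
    \sum_(i < k) beta c (x * ab true ^+ i) (ab true ^+ (k.-1 - i) * y).

Let Fixpoint Delta c x s y : C :=
  if s is f :: s' then
    (if f.1 then delta c x f.2 (val s' * y) else 0) + Delta c (x * ev f) s' y
  else 0.

Let betaDl c k x x' y : beta c (k *: x + x') y = k * beta c x y + beta c x' y.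
Proof.
by rewrite /beta mulrDl -scalerAl linearD linearZ mulrDl mulrA.
Qed.

Let betaDr c k x y y' : beta c x (k *: y + y') = k * beta c x y + beta c x y'.
Proof.
by rewrite /beta mulrDr -scalerAr linearD linearZ mulrDr mulrCA.
Qed.

Let delta_widen n c x q y : (size q <= n)%N -> delta c x q y =
  \sum_(k < n) q`_k *
    \sum_(i < k) beta c (x * ab true ^+ i) (ab true ^+ (k.-1 - i) * y).
Proof.
move=> le_qn; rewrite /delta (big_ord_widen _ (fun k => q`_k *
    \sum_(i < k) beta c (x * ab true ^+ i) (ab true ^+ (k.-1 - i) * y)) le_qn).
rewrite big_mkcond; apply: eq_bigr => k _; case: ltnP => // le_qk.
by rewrite nth_default ?mul0r.
Qed.

Let deltaD c x k q q' y :
  delta c x (k *: q + q') y = k * delta c x q y + delta c x q' y.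
Proof.
pose n := maxn (size (k *: q + q')) (maxn (size q) (size q')).
rewrite !(@delta_widen n) ?leq_max ?leqnn ?orbT // mulr_sumr -big_split /=.
by apply: eq_bigr => i _; rewrite coefD coefZ mulrDl mulrA.
Qed.

Let deltaDl c k x x' q y :
  delta c (k *: x + x') q y = k * delta c x q y + delta c x' q y.
Proof.
rewrite /delta mulr_sumr -big_split; apply: eq_bigr => j _ /=.
rewrite mulrCA -mulrDr; congr (_ * _); rewrite mulr_sumr -big_split.
by apply: eq_bigr => i _ /=; rewrite mulrDl -scalerAl betaDl.
Qed.

Let deltaDr c k x q y y' :
  delta c x q (k *: y + y') = k * delta c x q y + delta c x q y'.
Proof.
rewrite /delta mulr_sumr -big_split; apply: eq_bigr => j _ /=.
rewrite mulrCA -mulrDr; congr (_ * _); rewrite mulr_sumr -big_split.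
by apply: eq_bigr => i _ /=; rewrite mulrDr -scalerAr betaDr.
Qed.

Let delta1 c x y : delta c x 1 y = 0.
Proof. by rewrite /delta size_poly1 big_ord1 big_ord0 mulr0. Qed.

Let delta0 c x y : delta c x 0 y = 0.
Proof. by rewrite /delta size_poly0 big_ord0. Qed.

Let delta0r c x q : delta c x q 0 = 0.
Proof.
rewrite /delta big1 // => k _; rewrite big1 ?mulr0 // => i _.
by rewrite mulr0 /beta mulr0 linear0 mulr0.
Qed.

Let ev_sum i q : ev (i, q) = \sum_(k < size q) q`_k *: ab i ^+ k.
Proof.
rewrite /ev /= -[in LHS](coefK q) poly_def linear_sum; apply: eq_bigr => k _ /=.
by rewrite -mul_polyC rmorphM rmorphXn /= horner_algC horner_algX mulr_algl.
Qed.

Let deltaMX c x q y :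
  delta c x (q * 'X) y = delta c x q (ab true * y) + beta c (x * ev (true, q)) y.
Proof.
have le_size : (size (q * 'X)%R <= (size q).+1)%N.
  by rewrite (leq_trans (size_polyMleq _ _)) // size_polyX addn2.
rewrite (delta_widen _ _ _ le_size) big_ord_recl big_ord0 mulr0 add0r.
rewrite {2}/beta ev_sum !(mulr_sumr, mulr_suml) linear_sum mulr_suml.
rewrite /delta -big_split; apply: eq_bigr => k _ /=.
rewrite coefMX /= big_ord_recr /= subnn mul1r mulrDr; congr (_ * _ + _).
  apply: eq_bigr => i _; congr (beta _ _ _).
  rewrite add0n mulrA -exprSr; congr (_ ^+ _ * _).
  by have := ltn_ord i; lia.
by rewrite add0n -scalerAr -scalerAl linearZ /beta /= mulrA.
Qed.

(** Leibniz rule: the occurrence at which the product is cut lies in [q] or in [q']. It makes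
    [Delta] invariant under merging two neighbours. *)
Let deltaM c x q q' y : delta c x (q * q') y =
  delta c x q (ev (true, q') * y) + delta c (x * ev (true, q)) q' y.
Proof.
elim/poly_ind: q' y => [|q' e IHq] y.
  by rewrite mulr0 !delta0 /ev /= rmorph0 mul0r delta0r addr0.
have -> : q' * 'X + e%:P = e *: 1 + q' * 'X by rewrite alg_polyC addrC.
rewrite mulrDr mulrA -scalerAr mulr1 !deltaD !deltaMX IHq delta1 evD ev1 !evM.
rewrite evX mulrDl -scalerAl mul1r deltaDr !mulrA.
by ring.
Qed.

Let DeltaDl c k x x' s y :
  Delta c (k *: x + x') s y = k * Delta c x s y + Delta c x' s y.
Proof.
elim: s x x' => [|[i q] s IHs] x x' /=; first by rewrite mulr0 addr0.
rewrite mulrDl -scalerAl IHs.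
by case: i => /=; rewrite ?deltaDl; ring.
Qed.

Let DeltaDr c k x s y y' :
  Delta c x s (k *: y + y') = k * Delta c x s y + Delta c x s y'.
Proof.
elim: s x => [|[i q] s IHs] x /=; first by rewrite mulr0 addr0.
rewrite IHs mulrDr -scalerAr.
by case: i => /=; rewrite ?deltaDr; ring.
Qed.

Let Delta_cat c x s1 s2 y :
  Delta c x (s1 ++ s2) y =
  Delta c x s1 (val s2 * y) + Delta c (x * val s1) s2 y.
Proof.
elim: s1 x => [|[i q] s1 IHs] x /=; first by rewrite val_nil mulr1 add0r.
by rewrite IHs val_cons val_cat !mulrA addrA.
Qed.

Let centerP i q : exists2 q', phi (ev (i, q')) = 0 &
  ev (i, q) = phi (ev (i, q)) *: 1 + ev (i, q').
Proof.
pose e := phi (ev (i, q)); exists (- e *: 1 + q).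
  by rewrite evD ev1 linearD linearZ /= phi1 mulr1 addNr.
by rewrite evD ev1 addrA scaleNr subrr add0r.
Qed.

Let phi_alternating s :
  s != [::] -> alternating s -> centered s -> phi (val s) = 0.
Proof. exact: free_ab. Qed.

Let alternating_rcons s1 i q q' s2 :
  alternating (s1 ++ (i, q) :: s2) -> alternating (rcons s1 (i, q')).
Proof.
rewrite /alternating -cats1; case: s1 => [|f s1] //=.
by rewrite !cat_path => /and3P[-> /= ->].
Qed.

Let phi_alternating_rcons s i q :
  s != [::] -> alternating (rcons s (i, q)) -> centered s ->
  phi (val s * ev (i, q)) = 0.
Proof.
move=> s_neq0 alt_s cent_s; have [q' cent_q' ->] := centerP i q.
rewrite mulrDr -scalerAr mulr1 linearD linearZ /= phi_alternating //; last first.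
  by move: alt_s; rewrite /alternating -cats1; case: (s) => [|f s'] //=;
    rewrite cat_path => /andP[].
rewrite mulr0 add0r -val_rcons phi_alternating //.
- by case: (s).
- by move: alt_s; rewrite -cats1; apply: alternating_rcons.
- by move=> f; rewrite mem_rcons inE => /orP[/eqP -> //|]; apply: cent_s.
Qed.

(** The left part of each cut is a nonempty centered alternating word followed by a power of b. It
    is killed by [phi] although this last factor is not centered, since the mean of that factor only
    leaves a shorter word of the same kind. *)
Let Delta_alternating c s0 s y :
  s0 != [::] -> alternating (s0 ++ s) -> centered (s0 ++ s) ->
  Delta c (val s0) s y = 0.
Proof.
elim: s s0 => [|[i q] s IHs] s0 s0_neq0 alt_s cent_s //=.
rewrite -val_rcons IHs ?addr0 ?cat_rcons //; last by case: (s0).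
case: i alt_s cent_s => // alt_s cent_s.
rewrite /delta big1 // => k _; rewrite big1 ?mulr0 // => i _.
rewrite /beta -mulrA -exprSr.
have -> : ab true ^+ i.+1 = ev (true, 'X ^+ i.+1).
  by rewrite /ev rmorphXn /= horner_algX.
rewrite phi_alternating_rcons ?mul0r //.
  exact: alternating_rcons alt_s.
by move=> f f_s0; apply: cent_s; rewrite mem_cat f_s0.
Qed.

(** Only the mean of [ev (true, r)] survives: once [r] is centered, the word is alternating and
    centered both after the first factor is centered and after it is replaced by its mean. *)
Let phi_factor p r s : alternating ((true, r) :: s) -> centered s ->
  phi (ev (false, p) * (ev (true, r) * val s)) =
  phi (ev (true, r)) * phi (ev (false, p) * val s).
Proof.
move=> alt_s cent_s; have [r' cent_r' ->] := centerP true r.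
have alt_r' : alternating ((true, r') :: s).
  by move: alt_s; rewrite /alternating /=; case: (s).
have cent_s' : centered ((true, r') :: s).
  by move=> f; rewrite inE => /orP[/eqP -> //|]; apply: cent_s.
rewrite mulrDl -scalerAl mul1r mulrDr -scalerAr linearD linearZ /=.
rewrite linearD linearZ /= phi1 mulr1 cent_r' addr0 -val_cons.
suff -> : phi (ev (false, p) * val ((true, r') :: s)) = 0 by rewrite addr0.
have [p' cent_p' ->] := centerP false p.
rewrite mulrDl -scalerAl mul1r linearD linearZ /= phi_alternating // mulr0 add0r.
rewrite -val_cons phi_alternating //.
by move=> f; rewrite inE => /orP[/eqP -> //|]; apply: cent_s'.
Qed.

(** The recursion [moments_b] encodes that all free cumulants of b equal [kappa]; [nc_countS]
    derives it from noncrossing partitions. *)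
Variable kappa : C.
Hypothesis moments_b : forall n, phi (ab true ^+ n.+1) =
  kappa * phi (ab true ^+ n) +
  \sum_(i < n) phi (ab true ^+ i.+1) * phi (ab true ^+ (n.-1 - i)).

Let phi_b : phi (ab true) = kappa.
Proof.
by have := moments_b 0; rewrite expr1 expr0 phi1 mulr1 big_ord0 addr0.
Qed.

Let moments_bM q : phi (ab true * ev (true, q)) =
  kappa * phi (ev (true, q)) + delta 1 1 q 1.
Proof.
rewrite ev_sum mulr_sumr !linear_sum mulr_sumr -big_split.
apply: eq_bigr => k _ /=.
rewrite -scalerAr !linearZ /= -exprS moments_b mulrDr mulrCA; congr (_ + _ * _).
by apply: eq_bigr => i _; rewrite /beta mulr1 !mul1r exprSr.
Qed.

(* The Schwinger-Dyson equation of a variable whose free cumulants are all equal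
   to [kappa]. *)
Let schwinger_dyson p s : let c := ev (false, p) in
  phi (c * (ab true * val s)) = kappa * phi (c * val s) + Delta c 1 s 1.
Proof.
move=> c.
elim/alternating_centered_ind: s => [s1 i k q q' s2|s1 i s2|s1 i q q' s2|s].
- rewrite !val_cat !val_cons !Delta_cat /= !val_cons evD !mulr1 => IHq IHq'.
  set v := val s2 in IHq IHq' *.
  have lin u : u * ((k *: ev (i, q) + ev (i, q')) * v) =
      k *: (u * (ev (i, q) * v)) + u * (ev (i, q') * v).
    by rewrite mulrDl -scalerAl mulrDr -scalerAr.
  have lin3 x y (z : A * A) : x * (y * (k *: z.1 + z.2)) =
      k *: (x * (y * z.1)) + x * (y * z.2) :> A.
    by rewrite mulrDr -scalerAr mulrDr -scalerAr.
  rewrite (lin (val s1)) (lin3 c (ab true) (_, _)) linearD linearZ /= IHq IHq'.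
  rewrite (mulrDr c) -scalerAr linearD linearZ /= (mulrDl _ _ v).
  rewrite -scalerAl DeltaDr (mulrDr (1 * val s1)) -scalerAr DeltaDl.
  by case: (i); rewrite ?deltaD; ring.
- rewrite !val_cat !val_cons !Delta_cat /= !val_cons ev1 !mulr1 !mul1r => ->.
  by case: (i); rewrite ?delta1 add0r.
- rewrite !val_cat !val_cons !Delta_cat /= !val_cons evM !mulr1 -!mulrA => ->.
  by case: (i); rewrite ?deltaM ?mulrA; ring.
have pow_b j : ab true ^+ j = ev (true, 'X ^+ j).
  by rewrite /ev rmorphXn /= horner_algX.
have val1 f : val [:: f] = ev f by rewrite val_cons val_nil mulr1.
(* If the word is empty or begins in the algebra of a, then [Delta] vanishes and b splits off with
   its mean [kappa]. If it begins with a polynomial in b, then b is absorbed into it, and the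
   equation becomes [moments_bM] times [phi (c * val s)]. *)
case: s => [|[[] q] s] alt_s cent_s.
- by rewrite -(evX true) phi_factor // evX phi_b /= addr0.
- have alt_s' r : alternating ((true, r) :: s).
    by move: alt_s; rewrite /alternating /=; case: (s).
  have cent_s' : centered s.
    by move=> f f_s; apply: cent_s; rewrite inE f_s orbT.
  rewrite /= val_cons.
  have -> : Delta c (1 * ev (true, q)) s 1 = 0.
    by rewrite mul1r -val1 Delta_alternating.
  rewrite addr0 [ab true * _]mulrA -{1}(evX true) -evM !phi_factor // evM evX.
  rewrite moments_bM mulrDl mulrA; congr (_ + _).
  rewrite /delta mulr_suml; apply: eq_bigr => k _; rewrite -mulrA; congr (_ * _).
  rewrite mulr_suml; apply: eq_bigr => i _.
  by rewrite /beta !mulr1 !mul1r !pow_b phi_factor // mulrA.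
- rewrite -{1}(evX true) phi_factor // evX phi_b /= add0r.
  by rewrite mul1r -(val1 (false, q)) Delta_alternating // addr0.
Qed.

(** Schwinger-Dyson for c = a^(k+1) and w = (a b)^n: cutting w at an occurrence of b leaves (a b)^i
    a on the left and (a b)^(n-1-i) on the right. *)
Lemma free_mul_moments k n :
  phi (ab false ^+ k * (ab false * ab true) ^+ n.+1) =
  kappa * phi (ab false ^+ k.+1 * (ab false * ab true) ^+ n) +
  \sum_(i < n) phi ((ab false * ab true) ^+ i.+1) *
     phi (ab false ^+ k.+1 * (ab false * ab true) ^+ (n.-1 - i)).
Proof.
set a := ab false; set b := ab true.
pose w m : seq factor := flatten (nseq m [:: (false, 'X); (true, 'X)]).
have val_w m : val (w m) = (a * b) ^+ m.
  elim: m => [|m IHm]; first by rewrite val_nil expr0.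
  by rewrite /w /= !val_cons -/(w m) !evX IHm exprS mulrA.
have deltaX c x y : delta c x 'X y = beta c x y.
  rewrite /delta size_polyX 2?big_ord_recl big_ord0 big_ord1 !coefX /=.
  by rewrite big_ord0 !expr0 mulr1 !mul1r mulr0 add0r addr0.
have Delta_w c m j : Delta c ((a * b) ^+ j) (w m) 1 =
    \sum_(i < m) phi ((a * b) ^+ (j + i).+1) * phi (c * (a * b) ^+ (m.-1 - i)).
  elim: m j => [|m IHm] j; first by rewrite big_ord0.
  rewrite /w /= -/(w m) !evX deltaX add0r -mulrA -exprSr IHm big_ord_recl.
  rewrite addn0 subn0 mulr1 val_w /beta -mulrA -exprSr; congr (_ + _).
  apply: eq_bigr => i _; rewrite lift0 addnS addSn; congr (_ * phi (_ * _ ^+ _)).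
  by have := ltn_ord i; lia.
have := schwinger_dyson ('X ^+ k.+1) (w n); rewrite /= val_w.
have -> : ev (false, 'X ^+ k.+1) = a ^+ k.+1.
  by rewrite /ev rmorphXn /= horner_algX.
have := Delta_w (a ^+ k.+1) n 0%N; rewrite expr0 => -> <-.
by rewrite (exprSr a) exprS !mulrA.
Qed.

End Free.

Lemma free_mul_series (C : comNzRingType) (A : algType C) (phi : {scalar A})
    (ab : bool -> A) (kappa : C) (M : fps C) :
  phi 1 = 1 -> free_pair phi ab ->
  (forall n, phi (ab true ^+ n.+1) = kappa * phi (ab true ^+ n) +
     \sum_(i < n) phi (ab true ^+ i.+1) * phi (ab true ^+ (n.-1 - i))) ->
  (forall n, M n = phi ((ab false * ab true) ^+ n)) ->
  M = fps_comp (M - 1 + fps_const kappa) (Fps (fun n => phi (ab false ^+ n))).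
Proof.
move=> phi1 free_ab moments_b coefM.
set a := ab false; set b := ab true; set G := M - 1 + _; set f := Fps _.
(* These series satisfy [Q k = f k + fpsX * G * Q k.+1], which by [fps_compS] is also the recursion
   of the composites of the iterated shifts of [f]. *)
pose Q k : fps C := Fps (fun n => phi (a ^+ k * (a * b) ^+ n)).
have QE k n : Q k n = phi (a ^+ k * (a * b) ^+ n) by [].
have G0 : G 0%N = kappa.
  by rewrite /G coef_fpsD coef_fpsB coef_fps1 coefM expr0 phi1 subrr add0r.
have GS n : G n.+1 = phi ((a * b) ^+ n.+1).
  by rewrite /G coef_fpsD coef_fpsB coef_fps1 coefM subr0 addr0.
have QS k : Q k = fps_const (f k) + fpsX * G * Q k.+1.
  apply: fpsP => -[|n]; rewrite coef_fpsD -mulrA coef_fpsXM coef_fpsC.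
    by rewrite QE expr0 mulr1 addr0.
  rewrite QE (free_mul_moments phi1 free_ab moments_b) add0r coef_fpsM.
  rewrite big_ord_recl G0 subn0 QE; congr (_ + _); apply: eq_bigr => i _.
  by rewrite lift0 GS QE (_ : n.-1 - i = n - i.+1)%N //; lia.
suff QE' k : Q k = fps_comp G (iter k fps_shift f).
  by rewrite -[RHS](QE' 0%N); apply: fpsP => n; rewrite QE mul1r coefM.
have iter_shift i : iter k fps_shift f i = f (k + i)%N.
  elim: (k) i => [|k' IHk] i //=; rewrite coef_fps_shift IHk.
  by rewrite addnS addSn.
apply: fpsP => n; have [N] := ubnP n.
elim: N n k iter_shift => // N IHN n k iter_shift lt_nN.
rewrite QS fps_compS !coef_fpsD iter_shift addn0; congr (_ + _).
apply: coef_fpsXM_eq => i lt_in; rewrite -iterS; apply: IHN.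
  move=> j /=; rewrite coef_fps_shift iter_shift; congr (f _); lia.
by apply: leq_trans lt_in _.
Qed.

Lemma fps_comp_power (C : comNzRingType) (G f : fps C) (q : nat) :
  f = 1 + fpsX * f ^+ q ->
  fps_comp G f = 1 + fpsX * G * fps_comp G f ^+ q.
Proof.
by move=> def_f; rewrite {1}def_f fps_compD fps_comp1 fps_compXM fps_compXn.
Qed.

(** * Noncrossing partitions of intervals *)

Section NoncrossingSums.
Context {n : nat}.
Implicit Types (V W : {set {set 'I_n}}) (A B D : {set 'I_n}) (i j : 'I_n).

(** An elementwise form of [NCon]. Partitions of subsets [D] of one fixed ordinal spare any
    transport between ordinals when an interval is cut. *)
Record nc_partition V D : Prop := NcPartition {
  nc_neq0 : forall B, B \in V -> exists i, i \in B;
  nc_sub : forall B i, B \in V -> i \in B -> i \in D;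
  nc_cover : forall i, i \in D -> exists2 B, B \in V & i \in B;
  nc_eq : forall A B i, A \in V -> B \in V -> i \in A -> i \in B -> A = B;
  nc_cross : forall A B i j i' j', A \in V -> B \in V -> i \in A -> j \in B ->
    i' \in A -> j' \in B -> (i < j < i')%N -> (i' < j')%N -> A = B }.

Definition NCon D : {set {set {set 'I_n}}} :=
  [set V | finset.partition V D & noncrossing V].

Lemma nc_partitionP V D : reflect (nc_partition V D) (V \in NCon D).
Proof.
rewrite inE.
apply: (iffP andP) => [[/and3P[/eqP covV trV V0] ncV]|[V0 VD DV eqV ncV]].
  split.
  - move=> B VB; apply/finset.set0Pn; apply: contraNneq V0 => B0.
    by rewrite -B0.
  - by move=> B i VB Bi; rewrite -covV; apply/bigcupP; exists B.
  - by move=> i; rewrite -covV => /bigcupP[B VB Bi]; exists B.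
  - move=> A B i VA VB Ai Bi.
    by rewrite -(finset.def_pblock trV VA Ai) (finset.def_pblock trV VB Bi).
  - move=> A B i j i' j' VA VB Ai Bj Ai' Bj' /andP[lt_ij lt_ji'] lt_ij'.
    move: ncV => /forall_inP/(_ A VA)/forall_inP/(_ B VB)/forall_inP/(_ i Ai).
    move=> /forall_inP/(_ j Bj)/forall_inP/(_ i' Ai')/forall_inP/(_ j' Bj').
    by move=> /implyP crossAB; apply/eqP/crossAB; rewrite lt_ij lt_ji'.
split.
  apply/and3P; split.
  - apply/eqP/finset.setP => i; apply/bigcupP/idP => [[B VB Bi]|/DV[B VB Bi]].
      exact: VD VB Bi.
    by exists B.
  - apply/finset.trivIsetP => A B VA VB; apply: contraR => /pred0Pn[i /andP[Ai Bi]].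
    by apply/eqP; apply: eqV Ai Bi.
  - by apply/negP => /V0 E; case: E => i; rewrite finset.in_set0.
apply/forall_inP => A VA; apply/forall_inP => B VB; apply/forall_inP => i Ai.
apply/forall_inP => j Bj; apply/forall_inP => i' Ai'; apply/forall_inP => j' Bj'.
apply/implyP => /and3P[lt_ij lt_ji' lt_ij']; apply/eqP.
by apply: ncV Ai Bj Ai' Bj' _ lt_ij' => //; rewrite lt_ij.
Qed.

Lemma NCon_set0 : NCon finset.set0 = [set finset.set0].
Proof.
apply/finset.setP => V; rewrite !inE finset.partition_set0.
apply: andb_idr => /eqP ->; apply/forall_inP => A; by rewrite finset.in_set0.
Qed.

(** * Multiplicative weights and the decomposition by the block of the first point *)

Section Weight.
Context {R : comNzRingType}.
Variable wt : {set 'I_n} -> R.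

Definition NCsum D : R := \sum_(V in NCon D) \prod_(B in V) wt B.

Lemma NCsum0 : NCsum finset.set0 = 1.
Proof. by rewrite /NCsum NCon_set0 finset.big_set1 finset.big_set0. Qed.

Lemma nc_partition_sub V D1 D2 : nc_partition V D1 -> [disjoint D1 & D2] ->
  forall W, nc_partition W D2 -> (V :|: W) ::&: D1 = V.
Proof.
move=> ncV disD W ncW; apply/finset.setP => B; rewrite !inE.
apply/andP/idP => [[/orP[//|WB] /fintype.subsetP BD1]|VB].
  have [i Bi] := nc_neq0 ncW WB.
  by have:= disjointFr disD (BD1 i Bi); rewrite (nc_sub ncW WB Bi).
split; first by rewrite VB.
by apply/fintype.subsetP => i Bi; exact: (nc_sub ncV VB Bi).
Qed.

Lemma nc_partitionU V W D1 D2 : [disjoint D1 & D2] ->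
  (forall i j i' j', i \in D1 -> j \in D2 -> i' \in D1 -> j' \in D2 ->
     ~~ (((i < j < i') && (i' < j')) || ((j < i < j') && (j' < i'))))%N ->
  nc_partition V D1 -> nc_partition W D2 -> nc_partition (V :|: W) (D1 :|: D2).
Proof.
move=> disD crossD ncV ncW; split.
- by move=> B; rewrite inE => /orP[]; [exact: nc_neq0 ncV _|exact: nc_neq0 ncW _].
- move=> B i; rewrite !inE => /orP[VB|WB] Bi; apply/orP.
    by left; exact: (nc_sub ncV VB Bi).
  by right; exact: (nc_sub ncW WB Bi).
- move=> i; rewrite inE => /orP[D1i|D2i].
    by have [B VB Bi] := nc_cover ncV D1i; exists B => //; rewrite inE VB.
  by have [B WB Bi] := nc_cover ncW D2i; exists B => //; rewrite inE WB orbT.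
- move=> A B i; rewrite !inE => /orP[VA|WA] /orP[VB|WB] Ai Bi.
  + exact: (nc_eq ncV VA VB Ai Bi).
  + have := disjointFr disD (nc_sub ncV VA Ai).
    by rewrite (nc_sub ncW WB Bi).
  + have := disjointFr disD (nc_sub ncV VB Bi).
    by rewrite (nc_sub ncW WA Ai).
  + exact: (nc_eq ncW WA WB Ai Bi).
- move=> A B i j i' j'; rewrite !inE => /orP[VA|WA] /orP[VB|WB] Ai Bj Ai' Bj'.
  + exact: (nc_cross ncV VA VB Ai Bj Ai' Bj').
  + move=> ltij ltij'; have D1V := nc_sub ncV VA; have D2W := nc_sub ncW WB.
    have /negP[] := crossD i j i' j' (D1V _ Ai) (D2W _ Bj) (D1V _ Ai') (D2W _ Bj').
    by rewrite ltij ltij'.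
  + move=> ltij ltij'; have D1V := nc_sub ncV VB; have D2W := nc_sub ncW WA.
    have /negP[] := crossD j i j' i' (D1V _ Bj) (D2W _ Ai) (D1V _ Bj') (D2W _ Ai').
    by rewrite ltij ltij' orbT.
  + exact: (nc_cross ncW WA WB Ai Bj Ai' Bj').
Qed.

Lemma nc_partition_setI V D1 D2 : nc_partition V (D1 :|: D2) ->
  [disjoint D1 & D2] ->
  {in V, forall B, (B \subset D1) || (B \subset D2)} ->
  nc_partition (V ::&: D1) D1.
Proof.
move=> ncV disD blk; split.
- by move=> B; rewrite inE => /andP[VB _]; exact: (nc_neq0 ncV VB).
- by move=> B i; rewrite !inE => /andP[VB /fintype.subsetP]; apply.
- move=> i D1i; have D12i : i \in D1 :|: D2 by rewrite inE D1i.
  have [B VB Bi] := nc_cover ncV D12i; exists B => //; rewrite !inE VB.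
  have /orP[//|/fintype.subsetP/(_ i Bi)] := blk B VB.
  by rewrite (disjointFr disD D1i).
- move=> A B i; rewrite !inE => /andP[VA _] /andP[VB _].
  exact: (nc_eq ncV VA VB).
- move=> A B i j i' j'; rewrite !inE => /andP[VA _] /andP[VB _].
  exact: (nc_cross ncV VA VB).
Qed.

(** Restriction to [D1] and [D2] and union are mutually inverse, as no crossing can occur between
    the two sets. [Q] carries a side condition on the part in [D1]. *)
Lemma NCsum_split D1 D2 (Q : pred {set {set 'I_n}}) :
  [disjoint D1 & D2] ->
  (forall i j i' j', i \in D1 -> j \in D2 -> i' \in D1 -> j' \in D2 ->
     ~~ (((i < j < i') && (i' < j')) || ((j < i < j') && (j' < i'))))%N ->
  \sum_(V in NCon (D1 :|: D2) | [forall B in V, (B \subset D1) || (B \subset D2)]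
                                && Q (V ::&: D1)) \prod_(B in V) wt B =
  (\sum_(V in NCon D1 | Q V) \prod_(B in V) wt B) * NCsum D2.
Proof.
move=> disD crossD; have disD' : [disjoint D2 & D1] by rewrite disjoint_sym.
rewrite /NCsum mulr_suml (eq_bigr _ (fun V _ => mulr_sumr _ _ _ _)) pair_big /=.
rewrite (reindex_onto (fun p => p.1 :|: p.2) (fun V => (V ::&: D1, V ::&: D2))) /=;
  last first.
  move=> V /and3P[/nc_partitionP ncV /forall_inP blk _].
  by apply/finset.setP => B; rewrite !inE -andb_orr; apply: andb_idr; exact: blk.
rewrite (eq_bigl (fun p => (p.1 \in NCon D1) && Q p.1 && (p.2 \in NCon D2))).
  apply: eq_bigr => -[V W] /= /andP[/andP[/nc_partitionP ncV _] /nc_partitionP ncW].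
  rewrite -bigU; last first.
    apply/pred0Pn => -[B /andP[/= VB WB]]; have [i Bi] := nc_neq0 ncV VB.
    have := disjointFr disD (nc_sub ncV VB Bi).
    by rewrite (nc_sub ncW WB Bi).
  by apply: eq_bigl => B; rewrite !inE.
move=> [V W] /=; apply/andP/andP.
  move=> [/and3P[/nc_partitionP ncVW /forall_inP blk QV] /eqP[defV defW]].
  rewrite defV in QV; rewrite QV andbT.
  split; apply/nc_partitionP.
    by have := nc_partition_setI ncVW disD blk; rewrite defV.
  rewrite (finset.setUC D1) in ncVW.
  have := nc_partition_setI ncVW disD'; rewrite defW; apply=> B VWB.
  by rewrite orbC blk.
move=> [/andP[/nc_partitionP ncV QV] /nc_partitionP ncW].
have defV := nc_partition_sub ncV disD ncW.
have defW : (V :|: W) ::&: D2 = W.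
  by rewrite finset.setUC (nc_partition_sub ncW disD').
split; last by rewrite defV defW.
rewrite defV QV andbT; apply/andP; split; first exact/nc_partitionP/nc_partitionU.
apply/forall_inP => B; rewrite inE => /orP[VB|WB].
  by apply/orP; left; apply/fintype.subsetP => i Bi; exact: (nc_sub ncV VB Bi).
by apply/orP; right; apply/fintype.subsetP => i Bi; exact: (nc_sub ncW WB Bi).
Qed.

Definition seg (l r : nat) : {set 'I_n} := [set i : 'I_n | (l <= i < r)%N].

Definition NCsum_joined (l m : 'I_n) : R :=
  \sum_(V in NCon (seg l m.+1) | [exists B in V, (l \in B) && (m \in B)])
    \prod_(B in V) wt B.

(** The interval is cut after the largest element m of the block of [l]: a block with elements on
    both sides of the cut would cross that block. *)
Lemma NCsum_rec (l : 'I_n) (r : nat) : (l < r)%N -> NCsum (seg l r) =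
  \sum_(m : 'I_n | (l <= m < r)%N) NCsum_joined l m * NCsum (seg m.+1 r).
Proof.
move=> lt_lr; pose top V := [arg max_(i > l in finset.pblock V l) (i : nat)]%N.
have topP V : nc_partition V (seg l r) -> exists P,
    [/\ P \in V, l \in P, top V \in P & forall i, i \in P -> (i <= top V)%N].
  move=> ncV; have /nc_partitionP := ncV; rewrite inE => /andP[partV _].
  have cov_l : l \in finset.cover V.
    by rewrite (finset.cover_partition partV) inE leqnn.
  have pb_l : l \in finset.pblock V l by rewrite finset.mem_pblock.
  exists (finset.pblock V l); rewrite finset.pblock_mem // pb_l /top.
  by case: arg_maxnP => // i Pi max_i; split.
rewrite /NCsum (partition_big top (fun m => l <= m < r)%N) /=; last first.
  move=> V /nc_partitionP ncV; have [P [VP Pl Ptop maxP]] := topP V ncV.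
  by have := nc_sub ncV VP Ptop; rewrite inE.
apply: eq_bigr => m /andP[le_lm lt_mr].
have segU : seg l r = seg l m.+1 :|: seg m.+1 r.
  by apply/finset.setP => i; rewrite !inE; lia.
have disD : [disjoint seg l m.+1 & seg m.+1 r].
  by apply/pred0P => i; rewrite /= !inE; lia.
rewrite -[X in _ * X]/(NCsum _) /NCsum_joined -NCsum_split //; last first.
  by move=> i j i' j'; rewrite !inE; lia.
rewrite -segU; apply: eq_bigl => V; apply: andb_id2l => /nc_partitionP ncV.
have [P [VP Pl Ptop maxP]] := topP V ncV.
apply/eqP/andP => [def_m|[/forall_inP blk /exists_inP[B]]].
  rewrite def_m in Ptop maxP; have PD1 : P \subset seg l m.+1.
    apply/fintype.subsetP => i Pi; have := nc_sub ncV VP Pi.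
    by have := maxP i Pi; rewrite !inE; lia.
  split; last by apply/exists_inP; exists P; rewrite ?inE ?VP ?Pl.
  apply/forall_inP => B VB; have [->|neq_BP] := eqVneq B P; first by rewrite PD1.
  have notP i : i \in B -> i \notin P.
    by move=> Bi; apply: contra neq_BP => Pi; rewrite (nc_eq ncV VB VP Bi Pi).
  (* Such an [i] differs from [l] and [m], so it lies strictly between them, and any element of [B]
     beyond [m] would give a crossing with [P]. *)
  have [[i Bi le_im]|no_i] := pselect (exists2 i, i \in B & (i <= m)%N).
    apply/orP; left; apply/fintype.subsetP => i' Bi'.
    have := nc_sub ncV VB Bi'; have := nc_sub ncV VB Bi; rewrite !inE.
    move=> /andP[le_li _] /andP[-> _] /=; rewrite ltnS leqNgt.
    apply: contra neq_BP => lt_mi'; apply/eqP/esym.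
    apply: (nc_cross ncV VP VB Pl Bi Ptop Bi') => //.
    have neq_il : i != l by apply: contraTneq Pl => <-; exact: notP.
    have neq_im : i != m by apply: contraTneq Ptop => <-; exact: notP.
    by move: neq_il neq_im; rewrite -!val_eqE /=; lia.
  apply/orP; right; apply/fintype.subsetP => i Bi; have := nc_sub ncV VB Bi.
  rewrite !inE => /andP[_ ->]; rewrite andbT ltnNge; apply/negP => le_im.
  by apply: no_i; exists i.
rewrite inE => /andP[VB /fintype.subsetP BD1] /andP[Bl Bm].
have eqBP : B = P := nc_eq ncV VB VP Bl Pl.
apply/val_inj/eqP; rewrite eqn_leq maxP ?andbT -?eqBP //.
by have := BD1 (top V); rewrite eqBP => /(_ Ptop); rewrite inE ltnS => /andP[].
Qed.

Lemma NCon_single D : D != finset.set0 -> nc_partition [set D] D.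
Proof.
move=> /finset.set0Pn[i0 Di0]; split.
- by move=> B; rewrite inE => /eqP ->; exists i0.
- by move=> B i; rewrite inE => /eqP ->.
- by move=> i Di; exists D; rewrite ?inE.
- by move=> A B i; rewrite !inE => /eqP -> /eqP ->.
- by move=> A B i j i' j'; rewrite !inE => /eqP -> /eqP ->.
Qed.

Lemma NCsum_joined_refl l : NCsum_joined l l = wt [set l].
Proof.
have seg1 : seg l l.+1 = [set l].
  by apply/finset.setP => i; rewrite !inE -val_eqE /=; lia.
rewrite /NCsum_joined seg1 (big_pred1 [set [set l]]) ?finset.big_set1 // => V.
apply/andP/eqP => [[/nc_partitionP ncV /exists_inP[B VB /andP[Bl _]]]|->].
  have only A : A \in V -> A = [set l].
    move=> VA; apply/finset.setP => i; rewrite inE; apply/idP/eqP => [Ai|->].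
      by have := nc_sub ncV VA Ai; rewrite inE => /eqP.
    have [j Aj] := nc_neq0 ncV VA; have := nc_sub ncV VA Aj.
    by rewrite inE => /eqP <-.
  apply/finset.setP => A; rewrite inE; apply/idP/eqP => [/only //|->].
  by rewrite -(only B VB).
split.
  by apply/nc_partitionP/NCon_single/finset.set0Pn; exists l; rewrite inE.
by apply/exists_inP; exists [set l]; rewrite !inE ?eqxx.
Qed.

(** A block joining [l] and [m] with nonzero weight can only be the pair itself, which then splits
    off from the interior. *)
Lemma NCsum_joined_pair (l m : 'I_n) : (forall B, #|B| != 2%N -> wt B = 0) ->
  (l < m)%N -> NCsum_joined l m = wt [set l; m] * NCsum (seg l.+1 m).
Proof.
move=> wt0 lt_lm; pose P := [set l; m].
have cardP : #|P| = 2%N by rewrite cards2 -val_eqE /= ltn_eqF.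
have segU : seg l m.+1 = P :|: seg l.+1 m.
  by apply/finset.setP => i; rewrite !inE -!val_eqE /=; lia.
transitivity (\sum_(V in NCon (seg l m.+1) | P \in V) \prod_(B in V) wt B).
  rewrite /NCsum_joined [LHS]big_mkcondr [RHS]big_mkcondr.
  apply: eq_bigr => V /nc_partitionP ncV.
  case: ifPn => [/exists_inP[B VB /andP[Bl Bm]]|noB]; last first.
    case: ifPn => // VP; case/exists_inP: noB.
    by exists P; rewrite // !inE !eqxx orbT.
  have PB : P \subset B.
    by apply/fintype.subsetP => i; rewrite !inE => /orP[] /eqP ->.
  case: ifPn => // notVP; rewrite (bigD1 B) //= wt0 ?mul0r //.
  apply: contraNneq notVP => cardB; rewrite (_ : P = B) //.
  by apply/eqP; rewrite eqEcard PB cardB cardP.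
have disD : [disjoint P & seg l.+1 m].
  by apply/pred0P => i; rewrite /= !inE -!val_eqE /=; lia.
have /(_ (pred1 [set P])) := @NCsum_split P (seg l.+1 m) _ disD.
rewrite segU /= => split_P.
transitivity (\sum_(V in NCon (P :|: seg l.+1 m) | 
    [forall B in V, (B \subset P) || (B \subset seg l.+1 m)]
    && (V ::&: P == [set P])) \prod_(B in V) wt B).
  apply: eq_bigl => V; apply: andb_id2l => /nc_partitionP ncV.
  have Pl : l \in P by rewrite !inE eqxx.
  have Pm : m \in P by rewrite !inE eqxx orbT.
  apply/idP/andP => [VP|[_ /eqP defV]]; last first.
    by have : P \in V ::&: P; [rewrite defV inE|rewrite inE => /andP[]].
  have blk B : B \in V -> B != P -> B \subset seg l.+1 m.
    move=> VB neq_BP; apply/fintype.subsetP => i Bi.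
    have := nc_sub ncV VB Bi; rewrite inE => /orP[Pi|//].
    by rewrite (nc_eq ncV VB VP Bi Pi) eqxx in neq_BP.
  split.
    apply/forall_inP => B VB; have [->|neq_BP] := eqVneq B P.
      by rewrite fintype.subxx.
    by rewrite blk ?orbT.
  apply/eqP/finset.setP => B; rewrite !inE; apply/andP/eqP => [[VB BP]|->].
    apply: contraTeq BP => neq_BP; apply/fintype.subsetPn.
    have [i Bi] := nc_neq0 ncV VB; exists i => //.
    have := fintype.subsetP (blk B VB neq_BP) i Bi.
    by move=> seg_i; rewrite (disjointFl disD seg_i).
  by rewrite VP fintype.subxx.
rewrite split_P; last by move=> i j i' j'; rewrite !inE -!val_eqE /=; lia.
congr (_ * _); rewrite (big_pred1 [set P]) ?finset.big_set1 // => V.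
apply: andb_idl => /eqP ->; apply/nc_partitionP/NCon_single.
by apply/finset.set0Pn; exists l; rewrite !inE eqxx.
Qed.

End Weight.

(** * Constant weights: counting noncrossing partitions by their number of blocks *)

Section ConstantWeight.
Context {R : comNzRingType}.
Variables (t : R) (l m : 'I_n).
Hypothesis lt_lm : (l < m)%N.

Let add B := if l \in B then m |: B else B.
Let del B := B :\ m.

Let in_add B i : (i \in add B) = (i \in B) || (i == m) && (l \in B).
Proof.
by rewrite /add; case: ifP => _; rewrite ?inE ?andbT ?andbF ?orbF // orbC.
Qed.

Let neq_lm : l != m. Proof. by rewrite -val_eqE /= ltn_eqF. Qed.

Let nc_add V : nc_partition V (seg l m) ->
  nc_partition (add @: V) (seg l m.+1).
Proof.
move=> ncV; have VD B i : B \in V -> i \in B -> (l <= i < m)%N.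
  by move=> VB Bi; have := nc_sub ncV VB Bi; rewrite inE.
have Vm B : B \in V -> m \notin B.
  by move=> VB; apply/negP => /(VD B m VB); rewrite ltnn andbF.
split.
- move=> _ /imsetP[B VB ->]; have [i Bi] := nc_neq0 ncV VB.
  by exists i; rewrite in_add Bi.
- move=> _ i /imsetP[B VB ->]; rewrite in_add inE => /orP[/(VD B i VB)|].
    by lia.
  by move=> /andP[/eqP -> _]; lia.
- have cov i : (l <= i < m)%N -> exists2 B, B \in V & i \in B.
    by move=> D_i; apply: (nc_cover ncV); rewrite inE.
  move=> i; rewrite inE => D_i; have [->|neq_im] := eqVneq i m.
    have [|B VB Bl] := cov l; first by lia.
    by exists (add B); rewrite ?imset_f // in_add eqxx Bl orbT.
  have [|B VB Bi] := cov i; first by move: neq_im; rewrite -val_eqE /=; lia.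
  by exists (add B); rewrite ?imset_f // in_add Bi.
- move=> _ _ i /imsetP[A VA ->] /imsetP[B VB ->]; rewrite !in_add.
  have [->|neq_im] := eqVneq i m.
    rewrite (negPf (Vm A VA)) (negPf (Vm B VB)) /= => Al Bl.
    by rewrite (nc_eq ncV VA VB Al Bl).
  by rewrite /= !orbF => Ai Bi; rewrite (nc_eq ncV VA VB Ai Bi).
move=> _ _ i j i' j' /imsetP[A VA ->] /imsetP[B VB ->].
move=> Ai Bj Ai' Bj' lt_ij lt_ij'; congr add; move: Ai Bj Ai' Bj'.
have le_j'm : j' \in add B -> (j' <= m)%N.
  by rewrite in_add => /orP[/(VD B _ VB)|/andP[/eqP -> _]]; lia.
move=> Ai Bj Ai' Bj'; have {}le_j'm := le_j'm Bj'; move: Ai Bj Ai' Bj'.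
have [ne_i ne_j ne_i'] : [/\ i != m, j != m & i' != m].
  by rewrite -!val_eqE /=; split; lia.
rewrite !in_add (negPf ne_i) (negPf ne_j) (negPf ne_i') /= !orbF.
move=> Ai Bj Ai' /orP[Bj'|/andP[_ Bl]].
  exact: (nc_cross ncV VA VB Ai Bj Ai' Bj').
(* Here [j'] is the adjoined point [m], so [B] contains [l]. Unless [i] is [l], the points
   [l < i < j < i'] already cross in [V]. *)
have [eq_il|ne_il] := eqVneq i l.
  by rewrite eq_il in Ai; exact: (nc_eq ncV VA VB Ai Bl).
apply/esym/(nc_cross ncV VB VA Bl Ai Bj Ai'); last by lia.
by have := VD A i VA Ai; move: ne_il; rewrite -val_eqE /=; lia.
Qed.

Let nc_del V : nc_partition V (seg l m.+1) ->
  [exists B in V, (l \in B) && (m \in B)] -> nc_partition (del @: V) (seg l m).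
Proof.
move=> ncV /exists_inP[P VP /andP[Pl Pm]].
have in_del B i : (i \in del B) = (i != m) && (i \in B) by rewrite !inE.
split.
- move=> _ /imsetP[B VB ->]; have [i Bi] := nc_neq0 ncV VB.
  have [eq_im|neq_im] := eqVneq i m; last by exists i; rewrite in_del neq_im.
  rewrite eq_im in Bi; rewrite (nc_eq ncV VB VP Bi Pm).
  by exists l; rewrite in_del neq_lm.
- move=> _ i /imsetP[B VB ->]; rewrite in_del => /andP[neq_im Bi].
  by have := nc_sub ncV VB Bi; move: neq_im; rewrite !inE -val_eqE /=; lia.
- move=> i D_i; have [|B VB Bi] := @nc_cover _ _ ncV i.
    by move: D_i; rewrite !inE; lia.
  exists (del B); rewrite ?imset_f // in_del Bi andbT.
  by move: D_i; rewrite !inE -val_eqE /=; lia.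
- move=> _ _ i /imsetP[A VA ->] /imsetP[B VB ->]; rewrite !in_del.
  by move=> /andP[_ Ai] /andP[_ Bi]; rewrite (nc_eq ncV VA VB Ai Bi).
move=> _ _ i j i' j' /imsetP[A VA ->] /imsetP[B VB ->]; rewrite !in_del.
move=> /andP[_ Ai] /andP[_ Bj] /andP[_ Ai'] /andP[_ Bj'] lt_ij lt_ij'.
by rewrite (nc_cross ncV VA VB Ai Bj Ai' Bj' lt_ij lt_ij').
Qed.

Let addK V : nc_partition V (seg l m) -> {in V, cancel add del}.
Proof.
move=> ncV B VB; apply/finset.setP => i; rewrite !inE in_add.
have [->|] := eqVneq i m; last by rewrite orbF.
by apply/esym/negP => Bm; have := nc_sub ncV VB Bm; rewrite inE ltnn andbF.
Qed.

(** Removing [m] from the block which it shares with [l] is a bijection that keeps the number of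
    blocks, and a constant weight sees only this number. *)
Lemma NCsum_joined_const :
  NCsum_joined (fun=> t) l m = NCsum (fun=> t) (seg l m).
Proof.
rewrite /NCsum_joined (reindex_onto (fun V => add @: V) (fun V => del @: V)) /=;
  last first.
  move=> V /andP[/nc_partitionP ncV /exists_inP[P VP /andP[Pl Pm]]].
  rewrite -imset_comp -[RHS]imset_id; apply: eq_in_imset => B VB /=.
  apply/finset.setP => i; rewrite in_add !inE neq_lm /=.
  have [->|neq_im] := eqVneq i m; last by rewrite orbF.
  apply/idP/idP => [Bl|Bm] /=; first by rewrite (nc_eq ncV VB VP Bl Pl).
  by rewrite (nc_eq ncV VB VP Bm Pm).
apply: eq_big => [V|V].
  apply/andP/idP => [[/andP[/nc_partitionP ncV joined] /eqP <-]|].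
    exact/nc_partitionP/nc_del.
  move=> /nc_partitionP ncV; split; last first.
    rewrite -imset_comp -[X in _ == X]imset_id; apply/eqP/eq_in_imset => B VB.
    exact: (addK ncV VB).
  apply/andP; split; first exact/nc_partitionP/nc_add.
  have [|B VB Bl] := @nc_cover _ _ ncV l; first by rewrite inE leqnn.
  by apply/exists_inP; exists (add B); rewrite ?imset_f // !in_add eqxx Bl orbT.
move=> /andP[/andP[/nc_partitionP ncV joined] /eqP delK].
have {}ncV : nc_partition V (seg l m) by rewrite -delK; apply: nc_del.
rewrite !prodr_const card_in_imset //.
exact: can_in_inj (addK ncV).
Qed.

End ConstantWeight.

End NoncrossingSums.

Lemma seg_full (n : nat) : seg 0 n = [set: 'I_n].
Proof. by apply/finset.setP => i; rewrite !inE ltn_ord. Qed.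

Lemma seg_empty (n l : nat) : @seg n l l = finset.set0.
Proof. by apply/finset.setP => i; rewrite !inE; lia. Qed.

Lemma NCsum_const_rec (R : comNzRingType) (t : R) (n l k : nat) :
  (l + k.+1 <= n)%N ->
  let S l r := NCsum (fun=> t) (@seg n l r) in
  S l (l + k.+1)%N = t * S l.+1 (l + k.+1)%N +
    \sum_(i < k) S l (l + i.+1)%N * S (l + i.+2)%N (l + k.+1)%N.
Proof.
move=> le_n S; have lt_ln : (l < n)%N by lia.
rewrite /S (@NCsum_rec _ _ _ (Ordinal lt_ln)) /=; last by lia.
pose F m := (if m == l then t else S l m) * S m.+1 (l + k.+1)%N.
rewrite (eq_bigr (fun m : 'I_n => F m)) => [|m /= /andP[le_lm lt_m]]; last first.
  rewrite /F; congr (_ * _); have [eq_ml|neq_ml] := eqVneq (m : nat) l.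
    have -> : m = Ordinal lt_ln by apply: val_inj.
    by rewrite NCsum_joined_refl.
  by rewrite NCsum_joined_const //=; lia.
rewrite -(big_mkord (fun m => l <= m < l + k.+1)%N) /=.
rewrite (@big_cat_nat _ _ _ (l + k.+1)%N) //= [X in _ + X]big_nat_cond.
rewrite [X in _ + X]big_pred0 ?addr0 => [|m]; last by lia.
rewrite (@big_cat_nat _ _ _ l) //=; last by lia.
rewrite [X in X + _]big_nat_cond [X in X + _]big_pred0 ?add0r => [|m]; last by lia.
rewrite big_nat_cond (eq_bigl (fun m => (l <= m < l + k.+1) && true)%N); last first.
  by move=> m; lia.
rewrite -big_nat_cond -{1}[l]add0n big_addn addKn big_mkord big_ord_recl /F.
rewrite !add0n eqxx; congr (_ + _); apply: eq_bigr => i _ /=.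
rewrite /bump /= (_ : (_ == l) = false); last by lia.
by congr (S _ _ * S _ _); lia.
Qed.

Definition nc_count (R : comNzRingType) (t : R) (n : nat) : R :=
  \sum_(V in NC n) \prod_(B in V) t.

(** Invariance under translation and under change of the ambient ordinal follows from the common
    recursion, in place of a bijection. *)
Lemma nc_countE (R : comNzRingType) (t : R) (n l k : nat) : (l + k <= n)%N ->
  NCsum (fun=> t) (@seg n l (l + k)) = nc_count t k.
Proof.
have [K] := ubnP k; elim: K n l k => // K IHK n l [|k] lt_kK le_n.
  rewrite addn0 seg_empty NCsum0 -[RHS]/(NCsum (fun=> t) [set: 'I_0]).
  by rewrite -seg_full seg_empty NCsum0.
have rec n' l' : (l' + k.+1 <= n')%N ->
    NCsum (fun=> t) (@seg n' l' (l' + k.+1)) = t * nc_count t k +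
    \sum_(i < k) nc_count t i.+1 * nc_count t (k.-1 - i).
  move=> le_n'; rewrite NCsum_const_rec //; congr (t * _ + _).
    by rewrite -addSnnS IHK //; lia.
  apply: eq_bigr => i _; have lt_ik := ltn_ord i.
  rewrite IHK; [|lia|lia].
  by rewrite (_ : l' + k.+1 = l' + i.+2 + (k.-1 - i))%N ?IHK //; lia.
rewrite rec // -[RHS]/(NCsum (fun=> t) [set: 'I_k.+1]) -seg_full.
by rewrite -(rec k.+1 0%N).
Qed.

Lemma nc_count0 (R : comNzRingType) (t : R) : nc_count t 0 = 1.
Proof. by rewrite -(@nc_countE _ t 0 0 0) // seg_empty NCsum0. Qed.

Lemma nc_countS (R : comNzRingType) (t : R) (k : nat) :
  nc_count t k.+1 = t * nc_count t k +
    \sum_(i < k) nc_count t i.+1 * nc_count t (k.-1 - i).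
Proof.
rewrite -(@nc_countE _ t k.+1 0 k.+1) // NCsum_const_rec //; congr (t * _ + _).
  by rewrite -addSnnS nc_countE.
apply: eq_bigr => i _; have lt_ik := ltn_ord i; rewrite nc_countE; last by lia.
rewrite (_ : 0 + k.+1 = 0 + i.+2 + (k.-1 - i))%N; last by lia.
by rewrite nc_countE //; lia.
Qed.

(** The one-block partition contributes [kappa n], and all blocks of any other partition are
    smaller; so moments determine cumulants inductively. *)
Lemma nc_weights_unique (R : comNzRingType) (kappa : nat -> R) (t : R) :
  (forall n, \sum_(V in NC n) \prod_(B in V) kappa #|B| = nc_count t n) ->
  forall n, (0 < n)%N -> kappa n = t.
Proof.
move=> eq_sum n; have [N] := ubnP n; elim: N n => // N IHN [//|n] lt_nN _.
have full_neq0 : [set: 'I_n.+1] != finset.set0.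
  by apply/finset.set0Pn; exists ord0; rewrite inE.
have NCfull : [set [set: 'I_n.+1]] \in NC n.+1.
  exact/nc_partitionP/NCon_single.
have := eq_sum n.+1; rewrite /nc_count.
rewrite (bigD1 _ NCfull) [RHS](bigD1 _ NCfull) /= !finset.big_set1.
rewrite finset.cardsT card_ord.
move=> eq_n; apply: (addIr (\sum_(V in NC n.+1 | V != [set [set: 'I_n.+1]])
  \prod_(B in V) t)); rewrite -[RHS]eq_n; congr (_ + _).
apply: eq_bigr => V /andP[/nc_partitionP ncV neqV]; apply: eq_bigr => B VB.
symmetry.
have B_gt0 : (0 < #|B|)%N.
  by have [i Bi] := nc_neq0 ncV VB; apply/card_gt0P; exists i.
apply: IHN => //; suff: (#|B| < n.+1)%N.
  by move: lt_nN; rewrite ltnS => /[swap]; apply: leq_trans.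
have le_B : (#|B| <= n.+1)%N by have := max_card B; rewrite card_ord.
rewrite ltn_neqAle le_B andbT; apply/eqP => card_B.
have fullB : B = [set: 'I_n.+1].
  by apply/eqP; rewrite eqEcard finset.subsetT finset.cardsT card_ord card_B leqnn.
case/eqP: neqV; apply/finset.setP => A; rewrite !inE; apply/idP/eqP => [VA|->].
  have [i Ai] := nc_neq0 ncV VA; rewrite -fullB.
  by apply: (nc_eq ncV VA VB Ai); rewrite fullB inE.
by rewrite -fullB.
Qed.

(** * The word W_k *)

(* The letters of [W_k] at the positions [l < m] match if and only if [2 * p]
   divides [l + m + 1], and the right leg [m] is weighted by [t] if it carries
   the letter [p^*], which is the letter at the positions congruent to [p]. *)
Section OscillatingWord.
Context {C : comNzRingType}.
Variables (p P n : nat) (t : C) (M V : fps C) (S : nat -> nat -> C).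
Hypotheses (p_gt0 : (0 < p)%N) (defP : P = (2 * p)%N).
Let tau m : C := if (m %% P == p)%N then t else 1.
Hypothesis S_refl : forall l, S l l = 1.
Hypothesis S_rec : forall l r, (l < r)%N -> (r <= n)%N -> S l r =
  \sum_(m < n | ((l < m < r) && (P %| (l + m).+1))%N) tau m * (S l.+1 m * S m.+1 r).
Hypothesis defM : M = 1 + fps_const t * fpsX * V * M ^+ p.
Hypothesis defV : V = 1 + fpsX * M ^+ p * V.

Let X : fps C := fpsX.

(* The series of [S l r], where [l] is congruent to [s] and [r] is congruent to
   [s] for [same s], to [- s] for [opp s]. *)
Let same (s : nat) : fps C := if s == p then V else M.
Let opp s : fps C :=
  if (s < p)%N then fps_const t * X * V * M ^+ (p - s)
  else if s == p then X * V else X ^+ 2 * M ^+ (P - s).+1.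
(** The partner of a position congruent to s is congruent to -(s + 1), hence to p exactly when s + 1
    = p. *)
Let tau' s : fps C := if s.+1 == p then fps_const t else 1.

(** With m = P(q + i) - s - 1 the partner of l = Pq + s, the inside has type [opp s.+1] and index i,
    and the outside has type [opp (P - s)] and index k + 2 - i; hence the factor [X ^+ 2]. The
    summand [X ^+ 2] stands for the empty segment. *)
Let sameE s : (s < P)%N ->
  X ^+ 2 * same s = X ^+ 2 + tau' s * (opp s.+1 * opp (P - s)).
Proof.
move=> lt_sP; rewrite /same /tau' /opp.
have [lt_s1p|lt_ps1|eq_s1p] := ltngtP s.+1 p.
- rewrite (_ : (P - s < p)%N = false); last by lia.
  rewrite (_ : (P - s == p)%N = false); last by lia.
  rewrite (_ : (s == p)%N = false); last by lia.
  rewrite {1}defM mul1r mulrDr mulr1; congr (_ + _).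
  rewrite (_ : (P - (P - s)) = s)%N; last by lia.
  rewrite (_ : p = p - s.+1 + s.+1)%N ?exprD; last by lia.
  rewrite (_ : p - s.+1 + s.+1 - s.+1 = p - s.+1)%N; last by lia.
  by rewrite /X; ring.
- have [eq_sp|neq_sp] := eqVneq s p.
    rewrite (_ : (P - s < p)%N = false); last by lia.
    rewrite (_ : (P - s == p)%N = true); last by lia.
    rewrite {1}defV (_ : (P - s.+1).+1 = p)%N ?mul1r; last by lia.
    by rewrite /X; ring.
  rewrite (_ : (P - s < p)%N = true); last by lia.
  rewrite {1}defM mul1r mulrDr mulr1; congr (_ + _).
  rewrite (_ : p = (P - s.+1).+1 + (p - (P - s)))%N ?exprD; last by lia.
  rewrite (_ : (P - s.+1).+1 + (p - (P - s)) - (P - s) = p - (P - s))%N; last by lia.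
  by rewrite /X; ring.
- rewrite (_ : (P - s < p)%N = false); last by lia.
  rewrite (_ : (P - s == p)%N = false); last by lia.
  rewrite (_ : (s == p)%N = false); last by lia.
  rewrite {1}defM (_ : (P - (P - s)).+1 = p)%N; last by lia.
  by rewrite /X; ring.
Qed.

(** Now the outside has type [same (P - s)] and the indices add up to k. The summand X is the empty
    segment, possible only for s = p. Iterated, the identity yields one factor for each height
    between the ends of the segment and the turning point of the path: V at height p and M at every
    other height. *)
Let oppE s : (0 < s < P)%N ->
  opp s = (if s == p then X else 0) + tau' s * (opp s.+1 * same (P - s)).
Proof.
move=> lt_sP; rewrite /same /tau' /opp.
have [lt_s1p|lt_ps1|eq_s1p] := ltngtP s.+1 p.
- rewrite (_ : (P - s == p)%N = false); last by lia.
  rewrite (_ : (s == p)%N = false); last by lia.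
  by rewrite (_ : p - s = (p - s.+1).+1)%N ?exprS; [ring|lia].
- have [eq_sp|neq_sp] := eqVneq s p.
    rewrite (_ : (P - s == p)%N = true); last by lia.
    rewrite {1}defV (_ : (P - s.+1).+1 = p)%N ?mul1r; last by lia.
    by rewrite /X; ring.
  rewrite (_ : (P - s == p)%N = false); last by lia.
  by rewrite (_ : (P - s).+1 = (P - s.+1).+2)%N ?[_ ^+ _.+2]exprS; [ring|lia].
- rewrite (_ : (P - s == p)%N = false); last by lia.
  rewrite (_ : (s == p)%N = false); last by lia.
  by rewrite (_ : p - s = 1)%N ?expr1; [ring|lia].
Qed.

(** For these indices the right end would precede the left end. The vanishing completes a sum over
    actual partners to a full convolution. *)
Let opp_eq0 s i : (P * i < 2 * s)%N -> (s <= P)%N -> opp s i = 0.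
Proof.
move=> lt_is le_sP; rewrite /opp.
case: i lt_is => [|[|i]] lt_is; last first.
- have le_P : (P * 2 <= P * i.+2)%N by rewrite leq_mul2l orbT.
  by exfalso; lia.
- rewrite (_ : (s < p)%N = false); last by lia.
  rewrite (_ : (s == p)%N = false); last by lia.
  by rewrite expr2 -!mulrA coef_fpsXM coef_fpsXM.
case: ifP => _; first by rewrite -!mulrA coef_fpsCM coef_fpsXM mulr0.
by case: ifP => _; rewrite ?expr2 -?mulrA coef_fpsXM.
Qed.

(** The partners m of l are given by l + m + 1 = P(2q + i), which parametrizes them by i; the bound
    on r ensures that i is at most K. *)
Let sum_matches l r q s K (F : nat -> C) :
  l = (P * q + s)%N -> (s < P)%N -> (r <= n)%N -> (r + s < P * (q + K.+1))%N ->
  \sum_(m < n | ((l < m < r) && (P %| (l + m).+1))%N) F m =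
  \sum_(i < K.+1 | (l < P * (q + i) - s.+1 < r)%N) F (P * (q + i) - s.+1)%N.
Proof.
move=> def_l lt_sP le_rn lt_rK; have P_gt0 : (0 < P)%N by lia.
pose h m : 'I_K.+1 := inord ((l + m).+1 %/ P - 2 * q)%N.
have hE (m : 'I_n) : ((l < m < r) && (P %| (l + m).+1))%N ->
    m = (P * (q + h m) - s.+1)%N :> nat.
  move=> /andP[cond_m /dvdnP[j def_j]].
  have lt_jK : (j < 2 * q + K.+1)%N.
    by rewrite -(ltn_pmul2r P_gt0) -def_j def_l !mulnDl; lia.
  have le_qj : (2 * q <= j)%N.
    by rewrite -(leq_pmul2r P_gt0) -def_j; lia.
  have -> : h m = (j - 2 * q)%N :> nat by rewrite /h def_j mulnK // inordK; lia.
  have : (P * (q + (j - 2 * q)) + P * q = j * P)%N.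
    by rewrite -mulnDr mulnC; congr (_ * _)%N; lia.
  by lia.
rewrite (partition_big (fun m : 'I_n => h m) xpredT) //= [RHS]big_mkcond /=.
apply: eq_bigr => i _; case: ifPn => [cond_i|ncond_i].
  have val_i : (l + (P * (q + i) - s.+1)).+1 = ((2 * q + i) * P)%N by lia.
  have lt_n : (P * (q + i) - s.+1 < n)%N by lia.
  rewrite (big_pred1 (Ordinal lt_n)) // => m.
  apply/andP/eqP => [[cond_m /eqP def_i]|def_m].
    by apply: val_inj; rewrite /= hE // def_i.
  rewrite def_m /= cond_i val_i dvdn_mull //; split=> //.
  by apply/eqP/ord_inj; rewrite /h val_i mulnK // inordK; have := ltn_ord i; lia.
rewrite big1 // => m /andP[cond_m /eqP def_i]; case/negP: ncond_i.
by rewrite -def_i -hE //; case/andP: cond_m.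
Qed.

Lemma oscillating_word_moments q k :
  (P * (q + k) <= n)%N -> S (P * q) (P * (q + k)) = M k.
Proof.
(* The two congruence types feed each other, so both are proved at once by induction on the length
   of the segment. *)
suff main L l r : (r - l < L)%N -> (l <= r)%N -> (r <= n)%N ->
    (forall q k s, (s < P)%N -> l = (P * q + s)%N -> r = (P * (q + k) + s)%N ->
       S l r = same s k) /\
    (forall q k s, (0 < s <= P)%N -> l = (P * q + s)%N ->
       (r + s)%N = (P * (q + k))%N -> S l r = opp s k).
  move=> le_n; have le_qk : (P * q <= P * (q + k))%N by rewrite leq_mul2l; lia.
  have [/(_ q k 0%N)] := main _ _ _ (ltnSn _) le_qk le_n.
  rewrite !addn0 /same => -> //; last by lia.
  by rewrite (_ : (0 == p)%N = false); last by lia.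
elim: L l r {q k} => // L IHL l r lt_L le_lr le_rn.
have P_gt0 : (0 < P)%N by lia.
pose c s := if s.+1 == p then t else 1.
have tauE q s i : (s < P)%N -> (s < P * (q + i))%N ->
    tau (P * (q + i) - s.+1) = c s.
  move=> lt_sP lt_si; rewrite /tau /c.
  have -> : (P * (q + i) - s.+1 = P * (q + i).-1 + (P - s.+1))%N.
    by case: (q + i)%N lt_si => [|j]; rewrite ?muln0 //= mulnS; lia.
  rewrite mulnC modnMDl modn_small; last by lia.
  by rewrite (_ : (_ == _) = (s.+1 == p)); [case: ifP | lia].
(* The first-return step shared by both types: [f] is the series of the outside. Partners not to the
   right of l drop out by [opp_eq0], those not to the left of r by the last hypothesis. *)
have step q s K (f : fps C) : l = (P * q + s)%N -> (s < P)%N -> (l < r)%N ->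
    (r + s < P * (q + K.+1))%N ->
    (forall i j, (i + j)%N = K -> (l < P * (q + i) - s.+1 < r)%N ->
       S (P * (q + i) - s) r = f j) ->
    (forall i j, (i + j)%N = K -> (r <= P * (q + i) - s.+1)%N -> f j = 0) ->
    S l r = (tau' s * (opp s.+1 * f)) K.
  move=> def_l lt_sP lt_lr lt_rK fE f0.
  rewrite S_rec // (@sum_matches l r q s K
     (fun m => tau m * (S l.+1 m * S m.+1 r))) //.
  have -> : tau' s = fps_const (c s) by rewrite /tau' /c; case: ifP.
  rewrite coef_fpsCM coef_fpsM mulr_sumr big_mkcond; apply: eq_bigr => i _.
  have def_K : (i + (K - i))%N = K by have := ltn_ord i; lia.
  case: ifPn => [/andP[lt_li lt_ir]|].
    rewrite tauE //; last by lia.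
    congr (_ * (_ * _)); last first.
      rewrite -(fE _ _ def_K) ?lt_li //; congr (S _ _).
      by lia.
    have := IHL l.+1 (P * (q + i) - s.+1)%N.
    case=> [|||_ opp_case]; [by lia|by lia|by lia|].
    by apply: (opp_case q); lia.
  rewrite negb_and -!leqNgt => /orP[le_il|le_ri]; last first.
    by rewrite (f0 _ _ def_K) // !mulr0.
  by rewrite opp_eq0 ?mul0r ?mulr0 //; lia.
have M0 : M 0%N = 1.
  by rewrite defM coef_fpsD coef_fps1 -!mulrA coef_fpsCM coef_fpsXM mulr0 addr0.
have V0 : V 0%N = 1.
  by rewrite defV coef_fpsD coef_fps1 -!mulrA coef_fpsXM addr0.
have coefX2 (f : fps C) k : (X ^+ 2 * f) k.+2 = f k.
  by rewrite expr2 -mulrA !coef_fpsXM.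
have same_case q k s : (s < P)%N -> l = (P * q + s)%N ->
    r = (P * (q + k) + s)%N -> S l r = same s k.
  move=> lt_sP def_l def_r; case: k def_r => [|k] def_r.
    have -> : r = l by lia.
    by rewrite S_refl /same; case: ifP.
  have <- : (X ^+ 2 * same s) k.+3 = same s k.+1 by [].
  rewrite sameE // coef_fpsD -[X ^+ 2]mulr1 coefX2 coef_fps1 add0r.
  apply: (step q) => [//|//|||i j def_ij /andP[lt_li lt_ir]|i j def_ij le_ri].
  - by lia.
  - by lia.
  - case: i def_ij lt_li lt_ir => [|i] def_ij lt_li lt_ir; first by lia.
    have := IHL (P * (q + i.+1) - s)%N r.
    case=> [|||_ opp_case]; [by lia|by lia|by lia|].
    by apply: (opp_case (q + i)%N); lia.
  by rewrite opp_eq0 //; lia.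
split=> // q k s lt_sP def_l def_r; have [eq_sP|neq_sP] := eqVneq s P.
  (* [oppE] does not reach s = P. There both ends are multiples of P, so the segment is also of type
     [same 0], with index lowered by 2. *)
  case: k def_r => [|[|k]] def_r; [by lia|by lia|].
  rewrite (same_case q.+1 k 0%N); [|by lia|by lia|by lia].
  rewrite /same /opp eq_sP subnn expr1.
  rewrite (_ : (0 == p)%N = false); last by lia.
  rewrite (_ : (P < p)%N = false); last by lia.
  by rewrite (_ : (P == p)%N = false) ?coefX2; last by lia.
have [eq_lr|neq_lr] := eqVneq l r.
  have eq_sp : s = p.
    have : (P * k = 2 * s)%N by lia.
    by case: k def_r => [|[|k]]; lia.
  have -> : k = 1%N by case: k def_r => [|[|k]]; lia.
  by rewrite eq_lr S_refl /opp eq_sp ltnn eqxx coef_fpsXM V0.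
rewrite oppE; last by lia.
rewrite coef_fpsD.
have -> : (if s == p then X else 0) k = 0.
  case: eqP => // eq_sp; case: k def_r => [|[|k]] //; by lia.
rewrite add0r.
apply: (step q) => [//||||i j def_ij /andP[lt_li lt_ir]|i j def_ij le_ri].
- by lia.
- by lia.
- by lia.
- case: i def_ij lt_li lt_ir => [|i] def_ij lt_li lt_ir; first by lia.
  have := IHL (P * (q + i.+1) - s)%N r.
  case=> [|||same_case' _]; [by lia|by lia|by lia|].
  by apply: (same_case' (q + i)%N); lia.
- by have : (P * i <= P * k)%N; [rewrite leq_mul2l|]; lia.
Qed.

End OscillatingWord.

Lemma nth_word (p k i : nat) : (i < 2 * k * p)%N ->
  nth (0%N, false) (word p k) i =
  if (i %% (2 * p) < p)%N then ((i %% (2 * p)).+1, false)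
  else ((2 * p - i %% (2 * p))%N, true).
Proof.
elim: k i => [|k IHk] i lt_i; first by exfalso; lia.
rewrite /word /= nth_cat size_cat !size_map size_rev size_iota -/(word p k).
case: ltnP => [lt_i2p|le_2pi]; last first.
  rewrite IHk; last by lia.
  rewrite (_ : i %% (2 * p) = (i - (p + p)) %% (2 * p))%N //.
  by rewrite -{1}(subnK le_2pi) addnn -mul2n modnDr.
rewrite modn_small ?nth_cat ?size_map ?size_iota; last by lia.
case: ltnP => [lt_ip|le_pi].
  by rewrite (nth_map 0%N) ?size_iota // nth_iota // add1n.
rewrite (nth_map 0%N) ?size_rev ?size_iota; last by lia.
rewrite nth_rev ?size_iota; last by lia.
by rewrite nth_iota; [congr (_, _)|]; lia.
Qed.

(** * P_k as a weighted sum over all noncrossing partitions *)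

Section PkAsNCsum.
Context {R : comNzRingType}.
Variables (p k : nat) (d : nat -> R).
Local Notation N := (2 * k * p)%N.
Implicit Types (V : {set {set 'I_N}}) (B : {set 'I_N}) (i j l m : 'I_N).

(** A right leg counts in r_j if its letter is [(j, false)] and in r_(j+1) if its letter is
    [(j, true)]. *)
Let index i : nat := let: (j, star) := letter_at i in if star then j.+1 else j.

Let matching B : bool := (#|B| == 2%N) &&
  [forall x in B, forall y in B, (x != y) ==>
     ((letter_at x).1 == (letter_at y).1) && ((letter_at x).2 != (letter_at y).2)].

Let maximal B i : bool := [forall i' in B, (i' <= i)%N].

(** Weight 0 on all blocks but matching pairs makes the decomposition of [NCsum] applicable. On a
    pair the product has one factor, that of the right leg. *)
Definition word_weight B : R :=
  if matching B then \prod_(i in B | maximal B i) d (index i) else 0.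

Let indexP i : (1 <= index i < p.+2)%N.
Proof.
have : (0 < N)%N by case: posnP i => // -> [].
rewrite muln_gt0 => /andP[_ p_gt0]; rewrite /index /letter_at nth_word //.
have lt_mod : (i %% (2 * p) < 2 * p)%N by rewrite ltn_pmod // muln_gt0.
by case: ifP; lia.
Qed.

Lemma prod_right_legs V :
  \prod_(i : 'I_N | [exists B in V, (i \in B) && maximal B i]) d (index i) =
  \prod_(1 <= j < p.+2) d j ^+ r_exp V j.
Proof.
pose right i := [exists B in V, (i \in B) && maximal B i].
rewrite (eq_bigr (fun i => \prod_(1 <= j < p.+2 | j == index i) d j)) => [|i _].
  rewrite (exchange_big_dep xpredT) //=; apply: eq_big_nat => j /andP[j_gt0 _].
  rewrite prodr_const; congr (_ ^+ _); rewrite /r_exp.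
  rewrite -cardsUI (_ : _ :&: _ = finset.set0) ?cards0 ?addn0; last first.
    apply/finset.setP => i; rewrite !inE; apply/negP.
    by move=> /andP[/andP[/eqP -> _] /andP[/eqP]].
  apply: eq_card => i; rewrite !inE unfold_in /= -/(maximal _ _) -/(right i).
  rewrite /index; case: (letter_at i) => j' []; rewrite !xpair_eqE /=.
    rewrite eqxx andbF andbT andbC /=; congr (_ && _).
    by case: j j_gt0 => // j _; rewrite eqSS eq_sym.
  by rewrite eqxx andbF andbT orbF andbC eq_sym.
by rewrite big_nat1_eq indexP.
Qed.

Lemma PkE : Pk p k d = NCsum word_weight [set: 'I_N].
Proof.
rewrite /Pk /NCsum (eq_bigl (fun V => (V \in NC N) && [forall B in V, matching B])).
  rewrite big_mkcondr; apply: eq_bigr => V /nc_partitionP ncV.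
  case: ifPn => [/forall_inP all_matching|/forall_inPn[B VB nmatch]]; last first.
    by rewrite (bigD1 B) //= /word_weight (negPf nmatch) mul0r.
  rewrite -prod_right_legs big_mkcond.
  have /nc_partitionP := ncV; rewrite inE => /andP[partV _].
  rewrite (eq_bigl (fun i => i \in [set: 'I_N])) => [|i]; last first.
    by rewrite finset.in_setT.
  rewrite (finset.set_partition_big _ partV) /=; apply: eq_bigr => B VB.
  rewrite /word_weight all_matching // big_mkcondr; apply: eq_bigr => i Bi.
  congr (if _ then _ else _); apply/exists_inP/idP => [[A VA /andP[Ai]]|maxB].
    by rewrite (nc_eq ncV VB VA Bi Ai).
  by exists B; rewrite ?Bi.
move=> V; rewrite inE; congr (_ && _).
apply/andP/forall_inP => [[/forall_inP card2 /forall_inP match2] B VB|all_matching].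
  by rewrite /matching card2 ?match2.
by split; apply/forall_inP => B /all_matching /andP[].
Qed.

Lemma word_weight_card B : #|B| != 2%N -> word_weight B = 0.
Proof. by rewrite /word_weight /matching => /negPf ->. Qed.

(** A residue u < p carries the letter u + 1, and u >= p carries the adjoint of the letter 2p - u;
    the reflection u -> 2p - 1 - u exchanges a letter with its adjoint. *)
Lemma word_weight_pair l m : (l < m)%N -> word_weight [set l; m] =
  if (2 * p %| (l + m).+1)%N then d (if (m %% (2 * p) < p)%N then (m %% (2 * p)).+1
    else (2 * p - m %% (2 * p)).+1) else 0.
Proof.
move=> lt_lm; have neq_lm : l != m by rewrite -val_eqE /= ltn_eqF.
have : (0 < N)%N by case: posnP m {lt_lm neq_lm} => // -> [].
rewrite muln_gt0 => /andP[_ p_gt0].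
rewrite /word_weight; have -> : matching [set l; m] = (2 * p %| (l + m).+1)%N.
  rewrite /matching cards2 neq_lm eqxx /=.
  transitivity (((letter_at l).1 == (letter_at m).1) &&
                ((letter_at l).2 != (letter_at m).2)).
    apply/forall_inP/idP => [match_lm|match_lm x].
      have := match_lm l; rewrite !inE eqxx => /(_ isT) /forall_inP /(_ m).
      by rewrite !inE eqxx orbT neq_lm; apply.
    rewrite !inE => /orP[] /eqP ->; apply/forall_inP => y; rewrite !inE.
      by move=> /orP[] /eqP ->; rewrite ?eqxx // match_lm implybT.
    move=> /orP[] /eqP ->; rewrite ?eqxx //.
    rewrite (eq_sym (letter_at m).1) (eq_sym (letter_at m).2) match_lm.
    by rewrite implybT.
  rewrite /letter_at !nth_word //.
  have lt_l : (l %% (2 * p) < 2 * p)%N by rewrite ltn_pmod // muln_gt0.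
  have lt_m : (m %% (2 * p) < 2 * p)%N by rewrite ltn_pmod // muln_gt0.
  have -> : (2 * p %| (l + m).+1)%N = ((l %% (2 * p) + m %% (2 * p)).+1 == 2 * p)%N.
    have -> : ((l + m).+1 = (l %/ (2 * p) + m %/ (2 * p)) * (2 * p) +
        (l %% (2 * p) + m %% (2 * p)).+1)%N.
      by rewrite {1}(divn_eq l (2 * p)) {1}(divn_eq m (2 * p)); lia.
    rewrite (dvdn_addr _ (dvdn_mull _ (dvdnn _))).
    apply/dvdnP/eqP => [[[|[|j]] def_j]|->]; [by lia|by lia| |by exists 1%N; lia].
    have : (2 * p <= j * (2 * p) + 2 * p)%N by rewrite leq_addl.
    by lia.
  move: (l %% _)%N (m %% _)%N lt_l lt_m => r s lt_r lt_s.
  by do 2!case: ifP => /=; lia.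
case: ifP => // _.
rewrite (big_pred1 m); last first.
  move=> i; rewrite !inE; apply/andP/eqP => [[/orP[]/eqP ->]//|->].
    by move=> /forall_inP /(_ m); rewrite !inE eqxx orbT leqNgt lt_lm => /(_ isT).
  rewrite eqxx orbT; split=> //; apply/forall_inP => i'; rewrite !inE.
  by move=> /orP[] /eqP ->; lia.
by rewrite /index /letter_at nth_word //; case: ifP.
Qed.

End PkAsNCsum.

Lemma Pk_series (R : comNzRingType) (p k : nat) (d : nat -> R) (M V : fps R) :
  (0 < p)%N -> (forall j, (1 <= j <= p)%N -> d j = 1) ->
  M = 1 + fps_const (d p.+1) * fpsX * V * M ^+ p -> V = 1 + fpsX * M ^+ p * V ->
  Pk p k d = M k.
Proof.
move=> p_gt0 d1 defM defV.
pose S l r := NCsum (word_weight d) (@seg (2 * k * p) l r).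
rewrite PkE -seg_full -/(S 0%N (2 * k * p)%N).
transitivity (S (2 * p * 0)%N (2 * p * (0 + k))%N); first by congr (S _ _); lia.
apply: (@oscillating_word_moments _ p _ (2 * k * p)%N (d p.+1) M V S) => //.
- by move=> l; rewrite /S seg_empty NCsum0.
- move=> l r lt_lr le_rN; have lt_lN : (l < 2 * k * p)%N by lia.
  rewrite {1}/S (@NCsum_rec _ _ _ (Ordinal lt_lN)) // big_mkcond [RHS]big_mkcond.
  apply: eq_bigr => m _ /=; have [eq_ml|neq_ml] := eqVneq (m : nat) l.
    rewrite eq_ml ltnn /= leqnn lt_lr /=.
    have -> : m = Ordinal lt_lN by apply: val_inj.
    by rewrite NCsum_joined_refl word_weight_card ?cards1 // mul0r.
  rewrite leq_eqVlt eq_sym (negPf neq_ml) /=; case: ltnP => //= lt_lm.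
  case: ifP => //= lt_mr; rewrite NCsum_joined_pair //; last first.
    exact: word_weight_card.
  rewrite word_weight_pair //=; case: ifP => // _; rewrite ?mul0r // mulrA.
  congr (_ * _ * _).
  have lt_m : (m %% (2 * p) < 2 * p)%N by rewrite ltn_pmod // muln_gt0.
  case: ltnP => [lt_mp|le_pm]; first by rewrite ltn_eqF // d1.
  have [->|neq_mp] := eqVneq (m %% (2 * p))%N p.
    by congr (d _); lia.
  by rewrite d1 //; lia.
- by lia.
Qed.

Lemma Pk_functional_equation (F : fieldType) (p k : nat) (d : nat -> F) (t : F)
    (M : fps F) :
  (0 < p)%N -> t != 0 -> (forall j, (1 <= j <= p)%N -> d j = 1) -> d p.+1 = t ->
  M = 1 + fpsX * M ^+ p * (M - 1 + fps_const t) -> Pk p k d = M k.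
Proof.
move=> p_gt0 t_neq0 d1 dt defM.
have tV : fps_const t * fps_const t^-1 = 1.
  by apply: fpsP => n; rewrite coef_fpsCM coef_fpsC coef_fps1; case: n => [|n];
    rewrite ?mulr0 // divff.
pose V : fps F := 1 + fps_const t^-1 * (M - 1).
have VtE : fps_const t * V = M - 1 + fps_const t.
  by rewrite /V mulrDr mulr1 mulrA tV mul1r addrC.
move: V VtE => V VtE; apply: (@Pk_series _ _ _ _ M V) => //; rewrite ?dt.
  rewrite {1}defM -VtE; ring.
have cancel_t (f g : fps F) : fps_const t * f = fps_const t * g -> f = g.
  move=> /(congr1 ( *%R (fps_const t^-1))).
  by rewrite !mulrA [_ * fps_const t]mulrC tV !mul1r.
(* Multiplied by t, the equation for V is the one for M, since tV = M - 1 + t. *)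
apply: cancel_t; rewrite mulrDr mulr1 mulrCA VtE {1}defM; ring.
Qed.

(** * The Marchenko-Pastur law *)

Section Catalan.
Context {R : comNzRingType}.

Lemma nc_count_series (t : R) (N := Fps (nc_count t)) :
  N = 1 + fpsX * N * (N - 1 + fps_const t).
Proof.
apply: fpsP => -[|n]; rewrite coef_fpsD coef_fps1 -mulrA coef_fpsXM.
  by rewrite addr0 [LHS]nc_count0.
rewrite add0r [LHS]nc_countS [N * _]mulrC coef_fpsM big_ord_recl subn0.
congr (_ + _).
  rewrite !(coef_fpsD, coef_fpsN) coef_fps1 coef_fpsC.
  by rewrite [N 0%N]nc_count0 subrr add0r.
apply: eq_bigr => i _; rewrite lift0 !(coef_fpsD, coef_fpsN) coef_fps1 coef_fpsC.
rewrite subr0 addr0; congr (_ * nc_count t _); lia.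
Qed.

(* The Euler operator [X d/dX]. *)
Let theta (f : fps R) : fps R := Fps (fun n => n%:R * f n).

Let thetaE f n : theta f n = n%:R * f n. Proof. by []. Qed.

Let thetaM f g : theta (f * g) = theta f * g + f * theta g.
Proof.
apply: fpsP => n; rewrite coef_fpsD thetaE !coef_fpsM mulr_sumr -big_split.
apply: eq_bigr => i _ /=; rewrite !thetaE.
have le_in : (i <= n)%N by rewrite -ltnS.
rewrite -{1}(subnKC le_in) natrD; ring.
Qed.

(** Applying [theta] to C = 1 + X C^2 gives (1 - 2XC) theta C = X C^2. As (1 - 2XC)^2 = 1 - 4X,
    multiplying by 1 - 2XC leaves a linear differential equation, whose coefficients form a two-term
    recursion. *)
Lemma catalan_rec n :
  n.+2%:R * nc_count (1 : R) n.+1 = (4 * n + 2)%:R * nc_count (1 : R) n.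
Proof.
pose C := Fps (nc_count (1 : R)).
have defC : C = 1 + fpsX * C ^+ 2.
  by rewrite {1}/C nc_count_series subrK expr2 mulrA.
have thetaC : (1 - 2 * fpsX * C) * theta C = fpsX * C ^+ 2.
  have : theta C = fpsX * C ^+ 2 + 2 * fpsX * C * theta C.
    rewrite {1}defC; have -> : theta (1 + fpsX * C ^+ 2) = theta (fpsX * (C * C)).
      apply: fpsP => -[|i]; rewrite !thetaE ?mul0r // coef_fpsD coef_fps1.
      by rewrite add0r expr2.
    rewrite !thetaM; have -> : theta fpsX = fpsX :> fps R.
      by apply: fpsP => -[|[|i]]; rewrite thetaE ?mul0r ?mul1r ?mulr0.
    ring.
  by move=> eqT; rewrite mulrBl mul1r {1}eqT; ring.
have eqXC : fpsX * C ^+ 2 = C - 1 by rewrite [in RHS]defC; ring.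
have ode : theta C + C = 1 + fpsX * (4 * theta C + 2 * C).
  have sqr_u : (1 - 2 * fpsX * C) ^+ 2 = 1 - 4 * fpsX.
    transitivity (1 - 4 * fpsX * C + 4 * fpsX * (fpsX * C ^+ 2)); first by ring.
    by rewrite eqXC; ring.
  have : (1 - 4 * fpsX) * theta C = (1 - 2 * fpsX * C) * (fpsX * C ^+ 2).
    by rewrite -sqr_u -thetaC; ring.
  have -> : (1 - 2 * fpsX * C) * (fpsX * C ^+ 2) =
      fpsX * C ^+ 2 * (1 - 2 * fpsX * C) by ring.
  have -> : fpsX * C ^+ 2 * (1 - 2 * fpsX * C) = 1 - C + 2 * fpsX * C.
    rewrite eqXC.
    transitivity (C - 1 + 2 * fpsX * C - 2 * (fpsX * C ^+ 2)); first by ring.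
    by rewrite eqXC; ring.
  move=> eqC; transitivity ((1 - 4 * fpsX) * theta C + 4 * fpsX * theta C + C).
    by ring.
  by rewrite eqC; ring.
have nat_const (m : nat) (f : fps R) i : (m%:R * f) i = m%:R * f i.
  rewrite !mulr_natl; elim: m => [|m IHm]; last by rewrite !mulrS coef_fpsD IHm.
  by rewrite !mulr0n -[0]/(fps_const 0) coef_fpsC; case: i.
have := congr1 (fun f : fps R => f n.+1) ode.
rewrite !coef_fpsD coef_fps1 coef_fpsXM coef_fpsD !nat_const !thetaE add0r.
rewrite -[C n]/(nc_count 1 n) -[C n.+1]/(nc_count 1 n.+1) => rec_n.
transitivity (n.+1%:R * nc_count (1 : R) n.+1 + nc_count 1 n.+1).
  by rewrite -[n.+2]addn1 natrD; ring.
by rewrite rec_n natrD natrM; ring.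
Qed.

End Catalan.

(** * Integration against the Marchenko-Pastur law *)

Section MarchenkoPasturMoments.
Context {R : realType}.
Local Open Scope classical_set_scope.
Local Notation leb := (@lebesgue_measure R).
Local Notation MP := (marchenko_pastur : real_measure R).
Local Notation w := (@marchenko_pastur_pdf R).

Let integral_MP_indic E : measurable E ->
  (\int[MP]_x (\1_E x)%:E = \int[leb]_x (\1_E x * w x)%:E)%E.
Proof.
move=> mE; rewrite integral_indic//= setIT /marchenko_pastur integral_mkcond/=.
apply: eq_integral => x _; rewrite patchE indicE.
by case: (x \in E); rewrite ?mul1r ?mul0r.
Qed.

Import HBNNSimple.

Let integral_MP_nnsfun (f : {nnsfun (measurableTypeR R) >-> R}) :
  (\int[MP]_x (f x)%:E = \int[leb]_x (f x * w x)%:E)%E.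
Proof.
under [LHS]eq_integral do rewrite fimfunE -fsumEFin//.
rewrite [LHS]ge0_integral_fsum//; last 2 first.
  - by move=> r; exact/measurable_EFinP/measurableT_comp.
  - by move=> n x _; rewrite EFinM nnfun_muleindic_ge0.
under [RHS]eq_integral.
  move=> x xD; rewrite fimfunE EFinM -fsumEFin// muleC ge0_mule_fsumr; last first.
    by move=> r; rewrite EFinM nnfun_muleindic_ge0.
  over.
rewrite [RHS]ge0_integral_fsum//; last 2 first.
  - move=> r; apply: emeasurable_funM.
      by apply/measurable_EFinP; exact: measurable_marchenko_pastur_pdf.
    by apply/measurable_EFinP; exact/measurableT_comp.
  - move=> n x _; rewrite EFinM mule_ge0//; last by rewrite nnfun_muleindic_ge0.
    by rewrite lee_fin marchenko_pastur_pdf_ge0.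
apply: eq_fsbigr => r /[!inE] -[x _ fxr].
have r0 : 0 <= r by rewrite -fxr.
rewrite integralZl_indic_nnsfun//= integral_MP_indic// -ge0_integralZl//.
- by apply: eq_integral => y _; rewrite !EFinM [RHS]muleC muleA.
- apply/measurable_EFinP/measurable_funM; last first.
    exact: measurable_marchenko_pastur_pdf.
  exact: measurable_indic.
- by move=> y _; rewrite lee_fin mulr_ge0 ?marchenko_pastur_pdf_ge0.
Qed.

Let ge0_integral_MP (f : measurableTypeR R -> \bar R) :
  measurable_fun [set: measurableTypeR R] f -> (forall x, 0 <= f x)%E ->
  (\int[MP]_x f x = \int[leb]_x (f x * (w x)%:E))%E.
Proof.
move=> mf f0; pose f_ := nnsfun_approx measurableT mf.
transitivity (lim (\int[MP]_x (f_ n x)%:E @[n --> \oo])%E).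
  rewrite -monotone_convergence//=.
  - apply: eq_integral => ? /[!inE] xD; apply/esym/cvg_lim => //=.
    exact: cvg_nnsfun_approx.
  - by move=> n; exact/measurable_EFinP/measurable_funTS.
  - by move=> n ? _; rewrite lee_fin.
  - by move=> ? _ ? ? mn; rewrite lee_fin; exact/lefP/nd_nnsfun_approx.
transitivity (lim (\int[leb]_x ((f_ n x)%:E * (w x)%:E) @[n --> \oo])%E).
  by apply: congr_lim; apply/funext => n; exact: integral_MP_nnsfun.
rewrite -monotone_convergence//=.
- apply: eq_integral => x _; apply/cvg_lim => //=.
  by apply: cvgeZr => //; exact: cvg_nnsfun_approx.
- move=> n; apply: emeasurable_funM.
    exact/measurable_EFinP.
  by apply/measurable_EFinP; exact: measurable_marchenko_pastur_pdf.
- by move=> n x _; rewrite mule_ge0 ?lee_fin ?marchenko_pastur_pdf_ge0.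
- move=> x _ m n mn; rewrite lee_wpmul2r ?lee_fin ?marchenko_pastur_pdf_ge0//.
  exact/lefP/nd_nnsfun_approx.
Qed.

(** Multiplication by the nonnegative density commutes with positive and negative parts, which
    reduces to nonnegative functions, approximated by simple ones. *)
Lemma integral_marchenko_pastur (f : measurableTypeR R -> \bar R) :
  measurable_fun [set: measurableTypeR R] f ->
  (\int[MP]_x f x = \int[leb]_x (f x * (w x)%:E))%E.
Proof.
move=> mf; rewrite integralE [RHS]integralE; congr (_ - _)%E.
  rewrite ge0_integral_MP//; last exact: measurable_funepos.
  apply: eq_integral => x _; rewrite !funeposE.
  by rewrite muleC maxe_pMr ?lee_fin ?marchenko_pastur_pdf_ge0// mule0 muleC.
rewrite ge0_integral_MP//; last exact: measurable_funeneg.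
apply: eq_integral => x _; rewrite !funenegE.
by rewrite muleC maxe_pMr ?lee_fin ?marchenko_pastur_pdf_ge0// mule0 muleN muleC.
Qed.

End MarchenkoPasturMoments.

(** * The moment recursion of the Marchenko-Pastur law *)

Section MarchenkoPasturRec.
Context {R : realType}.
Local Open Scope classical_set_scope.
Local Notation leb := (@lebesgue_measure R).
Local Notation MP := (marchenko_pastur : real_measure R).
Local Notation w := (@marchenko_pastur_pdf R).

Let s (x : R) : R := Num.sqrt (x * (4 - x)).
(** An antiderivative of (4n + 2 - (n + 2) x) x^n times the density on ]0, 4[. It vanishes at 0 and
    at 4, so the integral of this derivative yields the recursion. *)
Let F n (x : R) : R := x ^+ n * (4 - x) * s x / (2 * pi).
Let coef n (x : R) : R := (4 * n + 2)%:R - n.+2%:R * x.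
Let H n (x : R) : R := coef n x * (x ^+ n * (s x / (2 * pi * x))).

Let s_derive (x : R) : 0 < x < 4 ->
  is_derive x 1 s ((2 * s x)^-1 * (4 - 2 * x)).
Proof.
move=> /andP[x0 x4].
have dg : is_derive x 1 (fun y : R => y * (4 - y)) (4 - 2 * x).
  apply: is_derive_eq; rewrite /GRing.scale /=; ring.
have pos : 0 < x * (4 - x) by rewrite mulr_gt0 // subr_gt0.
have := is_derive1_sqrt pos.
by move=> ?; apply: is_derive_eq; rewrite /s /GRing.scale /= mulrC.
Qed.

Let F_derive n (x : R) : 0 < x < 4 -> is_derive x 1 (F n) (H n x).
Proof.
move=> x04; have ds := s_derive x04; case/andP: x04 => x0 x4.
pose P : {poly R} := 'X^n * (4%:P - 'X).
have -> : F n = (2 * pi)^-1 \*: (horner P * s).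
  apply/funext => y; transitivity ((2 * pi)^-1 * (P.[y] * s y)) => //.
  rewrite /F /P hornerM hornerXn hornerD hornerN hornerC hornerX; ring.
have dF := is_deriveZ (2 * pi)^-1 (is_deriveM (is_derive_poly P x) ds).
apply: (is_derive_eq dF).
have s_gt0 : 0 < s x by rewrite /s sqrtr_gt0 mulr_gt0 // subr_gt0.
have sqr_s : s x ^+ 2 = x * (4 - x).
  by rewrite sqr_sqrtr // mulr_ge0 ?subr_ge0 // ltW.
have x_neq0 : x != 0 by rewrite gt_eqF.
have s_neq0 : s x != 0 by rewrite gt_eqF.
have pi_neq0 : pi != 0 :> R by rewrite gt_eqF // pi_gt0.
have dP : P^`().[x] = x ^+ n * (n%:R / x * (4 - x) - 1).
  rewrite derivM derivXn derivB derivC derivX sub0r hornerD !hornerM !hornerXn.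
  rewrite hornerMn !hornerXn hornerD !hornerN hornerC hornerX hornerC.
  case: n {P dF} => [|n]; first by rewrite !mulr0n expr0; field.
  rewrite /= -mulr_natl exprS; field.
  by [].
have def_s : (2 * s x)^-1 = s x / (2 * x * (4 - x)).
  by rewrite -mulrA -sqr_s; field.
have x4_neq0 : 4 - x != 0 by rewrite subr_eq0 gt_eqF.
rewrite /GRing.scale /= dP def_s /H /coef hornerM hornerXn hornerD hornerN hornerC.
rewrite hornerX; move: (pi : R) pi_neq0 => c c_neq0; field.
by rewrite x_neq0 x4_neq0 c_neq0.
Qed.

Let s_continuous : continuous s.
Proof.
move=> x; apply: continuous_comp; last exact: sqrt_continuous.
by apply: cvgM => //; apply: cvgB => //; exact: cvg_cst.
Qed.

Let F_continuous n : continuous (F n).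
Proof.
move=> x; apply: cvgM; last exact: cvg_cst.
apply: cvgM; last exact: s_continuous.
apply: cvgM; first exact: exprn_continuous.
by apply: cvgB => //; exact: cvg_cst.
Qed.

Let H_continuous n x : 0 < x -> {for x, continuous (H n)}.
Proof.
move=> x0; apply: cvgM.
  by apply: cvgB; [exact: cvg_cst|apply: cvgM => //; exact: cvg_cst].
apply: cvgM; first exact: exprn_continuous.
apply: cvgM; first exact: s_continuous.
apply: cvgV; first by rewrite !mulf_neq0 ?gt_eqF ?pi_gt0.
by apply: cvgM => //; exact: cvg_cst.
Qed.

(** The interval avoids 0, where the density is unbounded; the boundary term at 4 vanishes through
    the factor 4 - x. *)
Let integral_H n (e : R) : 0 < e < 4 ->
  (\int[leb]_(x in `[e, 4%R]) (H n x)%:E = (- F n e)%:E)%E.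
Proof.
move=> /andP[e0 e4]; rewrite (continuous_FTC2 (F := F n) e4).
- by rewrite /F subrr mulr0 !mul0r EFinN sub0e.
- apply: continuous_in_subspaceT => x; rewrite inE/= in_itv/= => /andP[ex _].
  by apply: H_continuous; exact: lt_le_trans ex.
- split.
  + move=> x; rewrite in_itv/= => /andP[ex x4].
    have [] // := F_derive n (x := x) _.
    by rewrite (lt_trans e0 ex).
  + by apply: cvg_at_right_filter; exact: F_continuous.
  + by apply: cvg_at_left_filter; exact: F_continuous.
- move=> x; rewrite in_itv/= => /andP[ex x4].
  rewrite derive1E; have [] // := F_derive n (x := x) _.
  by rewrite (lt_trans e0 ex).
Qed.

Let w_ge0 n x : 0 <= x ^+ n * w x.
Proof.
have [x0|x0] := ltP x 0; last first.
  by rewrite mulr_ge0 ?exprn_ge0 ?marchenko_pastur_pdf_ge0.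
by rewrite /marchenko_pastur_pdf (leNgt 0 x) x0 /= mulr0.
Qed.

Let measurable_w n :
  measurable_fun [set: measurableTypeR R] (fun x : R => x ^+ n * w x).
Proof.
by apply: measurable_funM => //; exact: measurable_marchenko_pastur_pdf.
Qed.

Lemma marchenko_pastur_moment_rec (m : nat -> R) n : has_moments MP m ->
  n.+2%:R * m n.+1 = (4 * n + 2)%:R * m n.
Proof.
move=> moments_m.
have int_w i : (\int[leb]_x (x ^+ i * w x)%:E = (m i)%:E)%E.
  by rewrite -moments_m integral_marchenko_pastur//; exact/measurable_EFinP.
(* The integrand is nonnegative with finite integral [m i], so integrability comes from
   [moments_m]. *)
have intble_w i : leb.-integrable [set: R] (fun x => (x ^+ i * w x)%:E).
  apply/integrableP; split; first exact/measurable_EFinP.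
  under eq_integral do rewrite gee0_abs ?lee_fin ?w_ge0//.
  by rewrite int_w ltry.
pose h x : R := coef n x * (x ^+ n * w x).
have hE x : (h x)%:E = ((4 * n + 2)%:R%:E * (x ^+ n * w x)%:E -
    n.+2%:R%:E * (x ^+ n.+1 * w x)%:E)%E.
  by rewrite -!EFinM -EFinB /h /coef exprS; congr (_%:E); ring.
have intble_h : leb.-integrable [set: R] (fun x => (h x)%:E).
  under eq_fun do rewrite hE.
  by apply: integrableB => //; apply: integrableZl.
have int_h : (\int[leb]_x (h x)%:E =
    ((4 * n + 2)%:R * m n - n.+2%:R * m n.+1)%:E)%E.
  under eq_integral do rewrite hE.
  rewrite integralB//; [|exact: integrableZl..].
  by rewrite !integralZl// !int_w EFinB !EFinM.
pose e (k : nat) : R := k.+1%:R^-1.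
have e_gt0 k : 0 < e k by rewrite invr_gt0.
have e_lt4 k : e k < 4.
  by rewrite (le_lt_trans (_ : _ <= 1)) ?invf_le1 ?ler1n ?ltr1n.
have cvg_e : e @ \oo --> 0 by exact: cvg_harmonic.
pose f k : R -> \bar R := (fun x => (h x)%:E) \_ `[e k, 4%R].
have int_f k : (\int[leb]_x f k x = (- F n (e k))%:E)%E.
  rewrite -integral_mkcond -integral_H ?e_gt0 ?e_lt4//.
  apply: eq_integral => x; rewrite inE/= in_itv/= => /andP[ex x4].
  have x0 : 0 < x by apply: lt_le_trans ex.
  by rewrite /h /H /marchenko_pastur_pdf ltW// x4.
have f_h x : f ^~ x @ \oo --> (h x)%:E.
  (* On ]0, 4] the sequence is eventually constant. Elsewhere [h x = 0], also at 0, because [0^-1]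
     is 0. *)
  have [/andP[x0 x4]|nx] := boolP (0 < x <= 4); last first.
    have hx0 : h x = 0.
      rewrite /h /marchenko_pastur_pdf; case: ifP => [/andP[x0 x4]|]; last first.
        by rewrite !mulr0.
      have -> : x = 0.
        by apply/eqP; rewrite eq_le x0 andbT leNgt; move: nx; rewrite x4 andbT.
      by rewrite mulr0 invr0 !mulr0.
    rewrite (_ : f ^~ x = cst 0%E); first by rewrite hx0; exact: cvg_cst.
    by apply/funext => k; rewrite /f patchE hx0; case: ifP.
  apply: cvg_near_cst; near=> k; rewrite /f patchE mem_set//= in_itv/= x4 andbT.
  by apply: ltW; near: k; exact: (cvgr_lt 0 cvg_e).
have f_le k x : (`|f k x| <= `|(h x)%:E|)%E.
  by rewrite /f patchE; case: ifP => // _; rewrite abse0 abse_ge0.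
have cvg_f : (\int[leb]_x f k x)%E @[k --> \oo] --> (\int[leb]_x (h x)%:E)%E.
  have [] := @dominated_convergence _ _ R leb [set: R] measurableT f
    (fun x => (h x)%:E) (fun x => `|(h x)%:E|%E) => //.
  - move=> k; apply/(measurable_restrictT _ _).1 => //.
    by apply: measurable_funTS; exact: measurable_int intble_h.
  - exact: measurable_int intble_h.
  - by apply/aeW => x _; exact: f_h.
  - exact: integrable_abse.
  - by apply/aeW => x k _; exact: f_le.
have cvg_F : (\int[leb]_x f k x)%E @[k --> \oo] --> (- F n 0)%:E.
  under eq_fun do rewrite int_f.
  apply: cvg_EFin; first exact: nearW.
  have cF : F n (e k) @[k --> \oo] --> F n 0.
    by apply: continuous_cvg => //; exact: F_continuous.
  exact: cvgN cF.
have : (\int[leb]_x (h x)%:E)%E = (- F n 0)%:E.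
  by rewrite -(cvg_lim _ cvg_f) // (cvg_lim _ cvg_F).
rewrite int_h /F /s mul0r sqrtr0 mulr0 mul0r oppr0 => -[].
by move=> /eqP; rewrite subr_eq0 => /eqP.
Unshelve. all: by end_near. 
Qed.

End MarchenkoPasturRec.

(** * Free Bessel laws *)

Section Moments.
Context {R : realType}.
Local Open Scope classical_set_scope.
Local Notation MP := (marchenko_pastur : real_measure R).
Implicit Types (mu nu rho : real_measure R) (m : nat -> R).

Lemma has_moments_unique mu m m' : has_moments mu m -> has_moments mu m' -> m =1 m'.
Proof. by move=> mom mom' n; have := mom n; rewrite mom' => -[]. Qed.

Lemma nc_sum_const (kappa : nat -> R) (t : R) :
  (forall n, (0 < n)%N -> kappa n = t) ->
  forall n, \sum_(V in NC n) \prod_(B in V) kappa #|B| = nc_count t n.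
Proof.
move=> kappaE n; apply: eq_bigr => V /nc_partitionP ncV; apply: eq_bigr => B VB.
by apply: kappaE; have [i Bi] := nc_neq0 ncV VB; apply/card_gt0P; exists i.
Qed.

Lemma marchenko_pastur_moments m :
  has_moments MP m -> m 0%N = 1 -> m =1 nc_count 1.
Proof.
move=> moments_m m0; elim=> [|n IHn]; first by rewrite m0 nc_count0.
have n2_neq0 : n.+2%:R != 0 :> R by rewrite pnatr_eq0.
apply: (mulfI n2_neq0).
by rewrite (marchenko_pastur_moment_rec _ moments_m) IHn catalan_rec.
Qed.

(** The total mass 1, which the recursion leaves open, is forced by the cumulant hypothesis: the
    moment of order 0 is the sum over the only partition of the empty set, with the empty product as
    its term. *)
Lemma marchenko_pastur_cumulants (kappa : nat -> R) : is_free_cumulants MP kappa ->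
  has_moments MP (nc_count 1) /\ forall n, (0 < n)%N -> kappa n = 1.
Proof.
move=> cumul; have sum0 : \sum_(V in NC 0) \prod_(B in V) kappa #|B| = 1 :> R.
  rewrite -[LHS]/(NCsum (fun B => kappa #|B|) [set: 'I_0]%SET) -seg_full.
  by rewrite seg_empty NCsum0.
have momE := marchenko_pastur_moments cumul sum0.
split; last exact: nc_weights_unique momE.
by move=> n; rewrite cumul momE.
Qed.

(** Coefficients are taken in [R[i]], where the functionals [phi] have their values. *)
Let series m : fps R[i] := Fps (fun n => (m n)%:C%C).

Lemma free_mul_conv_series mu nu rho (t : R) :
  free_mul_conv mu nu rho -> has_moments nu (nc_count t) ->
  exists m1 m2, [/\ has_moments mu m1, has_moments rho m2 &
    series m2 = fps_comp (series m2 - 1 + fps_const t%:C%C) (series m1)].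
Proof.
move=> [_ _ _ [A [phi [a [b [phi1 free_ab [m1 mom1 phia] [m3 mom3 phib]
  [m2 mom2 phiab]]]]]]] mom_nu.
exists m1, m2; split=> //.
have m3E := has_moments_unique mom3 mom_nu.
have := @free_mul_series _ A phi (fun i => if i then b else a) t%:C%C
  (series m2) phi1 free_ab.
have -> : Fps (fun n => phi ((fun i : bool => if i then b else a) false ^+ n)) =
    series m1 by apply: fpsP => n; rewrite /fps_coef /= phia.
apply=> /= n; last by rewrite phiab.
rewrite !phib !m3E nc_countS rmorphD rmorphM; congr (_ + _); rewrite rmorph_sum.
by apply: eq_bigr => i _; rewrite !phib !m3E rmorphM.
Qed.

Lemma free_mul_power_series n (rho : real_prob R) :
  has_moments MP (nc_count 1) -> free_mul_power MP n rho ->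
  exists2 m, has_moments rho m & series m = 1 + fpsX * series m ^+ n.+1.
Proof.
move=> mom_MP; elim: n rho => [|n IHn] rho /=.
  (* The Dirac mass at 1 has the series 1/(1 - z), which solves the equation with exponent 1. *)
  move=> rhoE; exists (fun=> 1).
    move=> k; rewrite (eq_measure_integral (\d_(1 : measurableTypeR R))).
      rewrite integral_dirac//= ?diracT ?mul1e ?expr1n//.
      exact/measurable_EFinP.
    by move=> A mA _; exact: rhoE.
  apply: fpsP => -[|i]; rewrite coef_fpsD coef_fps1 coef_fpsXM ?addr0 // add0r.
  by rewrite expr1.
move=> [nu /IHn[m mom_nu def_m] conv].
have [m1 [m2 [mom1 mom2 m2E]]] := free_mul_conv_series conv mom_MP.
exists m2 => //.
(* For cumulants equal to 1 the shift s - 1 vanishes, and the substituted series is z M(z). *)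
have {}m2E : series m2 = fps_comp (series m2) (series m1).
  by rewrite {1}m2E (_ : fps_const 1%:C%C = 1 :> fps R[i]) ?subrK //.
have def_m1 : series m1 = 1 + fpsX * series m1 ^+ n.+1.
  have -> // : series m1 = series m.
  by apply: fpsP => i; congr (_%:C%C); exact: has_moments_unique mom1 mom_nu i.
rewrite {1}m2E (fps_comp_power (series m2) def_m1) -m2E [series m2 ^+ _.+2]exprS.
rewrite mulrA; reflexivity.
Qed.

End Moments.

Theorem corollary9p3 (R : realType) (p : nat) (t : R) (d : nat -> R)
    (mu : real_prob R) :
  (0 < p)%N -> 0 < t ->
  (forall j : nat, (1 <= j <= p)%N -> d j = 1) -> d p.+1 = t ->
  free_bessel_law p t mu ->
  forall k : nat, ((Pk p k d)%:E = \int[mu]_x (x ^+ k)%:E)%E.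
Proof.
move=> p_gt0 t_gt0 d1 dt [nu1 [nu2 [power [_ _ [kappa cumul_MP cumul_nu2]] conv]]] k.
have [mom_MP kappa1] := marchenko_pastur_cumulants cumul_MP.
have mom_nu2 : has_moments nu2 (nc_count t).
  move=> n.
  rewrite cumul_nu2 (nc_sum_const (kappa := fun i => t * kappa i) (t := t)) //.
  by move=> i i_gt0; rewrite kappa1 // mulr1.
have [m1 mom1 def_m1] := free_mul_power_series mom_MP power.
have [m2 [m [mom2 mom_mu defM]]] := free_mul_conv_series conv mom_nu2.
set M := Fps _ in defM.
pose f2 : fps R[i] := Fps (fun n => (m2 n)%:C%C).
have def_m2 : f2 = 1 + fpsX * f2 ^+ p.
  rewrite -(prednK p_gt0) -(_ : Fps (fun n => (m1 n)%:C%C) = f2) //.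
  by apply: fpsP => i; congr (_%:C%C); exact: has_moments_unique mom1 mom2 i.
rewrite mom_mu; congr (_%:E).
(* P_k commutes with the injective embedding of [R] into [R[i]], where [M] lives. *)
apply: (fmorph_inj (real_complex R)).
transitivity (Pk p k (fun j => (d j)%:C%C)).
  rewrite /Pk rmorph_sum; apply: eq_bigr => V _; rewrite rmorph_prod.
  by apply: eq_bigr => j _; rewrite rmorphXn.
rewrite (@Pk_functional_equation _ p k _ t%:C%C M) //.
- by rewrite fmorph_eq0 gt_eqF.
- by move=> j jp; rewrite d1.
- by rewrite dt.
rewrite {1}defM (fps_comp_power _ def_m2) -defM; ring.
Qed.
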